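(* Let $R$ and $S$ be connected graphs with $R\neq P_3$ and $S\neq P_3$. Then the statement ''every $2$-connected $\{R,S\}$-heavy graph is Hamiltonian'' holds if and only if, up to interchanging $R$ and $S$, $R=K_{1,3}$ and $S$ is one of $P_4,P_5,C_3,Z_1,Z_2,B,N$ or $W$.
   Context: All graphs are finite and simple. Let $G$ be a graph on $n$ vertices. An induced subgraph $H'$ of $G$ is called heavy if there exist two nonadjacent vertices in $H'$ whose degree sum in $G$ is at least $n$. For a graph $H$, $G$ is $H$-heavy if every induced subgraph of $G$ isomorphic to $H$ is heavy; for a family $\mathcal{H}$, $G$ is $\mathcal{H}$-heavy if it is $H$-heavy for every $H\in\mathcal{H}$. Notation: $P_i$ is the path on $i$ vertices; $C_3$ is the triangle; $K_{1,3}$ is the claw (star with three leaves); $Z_i$ is the graph obtained from a triangle by attaching at one of its vertices a pendant path with $i$ edges (so $Z_i$ has $i+3$ vertices); $B$ (bull) is a triangle with a pendant edge attached at each of two distinct vertices; $N$ (net) is a triangle with a pendant edge attached at each of its three vertices; $W$ (wounded) is a triangle $abc$ with a pendant edge attached at $a$ and a pendant path of length $2$ attached at $b$.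
   Formalization: R and S are also assumed to have at least three vertices: if R or S is K_1 or K_2, no 2-connected graph is {R,S}-heavy, so the Hamiltonicity statement holds vacuously although the pair is not on the list. *)

(* Defs.v *)
From mathcomp Require Import all_boot.

Set Implicit Arguments.
Unset Strict Implicit.
Unset Printing Implicit Defensive.

Record sgraph := SGraph {
  vertex :> finType;
  adj : rel vertex;
  adj_sym : symmetric adj;
  adj_irr : irreflexive adj
}.

Definition deg (G : sgraph) (v : G) : nat := #|[set w : G | adj v w]|.

Section Induced.
Variables (G : sgraph) (A : {set G}).

Definition induced_adj : rel {x : G | x \in A} :=
  fun x y => adj (val x) (val y).

Lemma induced_adj_sym : symmetric induced_adj.
Proof. by move=> x y; apply: adj_sym. Qed.

Lemma induced_adj_irr : irreflexive induced_adj.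
Proof. by move=> x; apply: adj_irr. Qed.

Definition induced : sgraph := SGraph induced_adj_sym induced_adj_irr.

End Induced.

Definition isomorphic (G H : sgraph) : Prop :=
  exists f : G -> H, bijective f /\ forall x y, adj (f x) (f y) = adj x y.

Definition connected (G : sgraph) : Prop :=
  0 < #|G| /\ forall x y : G, connect (@adj G) x y.

Definition k_connected (k : nat) (G : sgraph) : Prop :=
  k < #|G| /\ forall A : {set G}, #|A| < k -> connected (induced (~: A)).

Definition hamiltonian (G : sgraph) : Prop :=
  exists c : seq G,
    [/\ 2 < size c, uniq c, cycle (@adj G) c & forall v : G, v \in c].

(* Degrees and order are those of G, not of the subgraph induced by A. *)
Definition heavy_set (G : sgraph) (A : {set G}) : Prop :=
  exists u v : G,
    [/\ u \in A, v \in A, u != v, ~~ adj u v & #|G| <= deg u + deg v].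

Definition heavy (H G : sgraph) : Prop :=
  forall A : {set G}, isomorphic (induced A) H -> heavy_set A.

Definition family_heavy (F : sgraph -> Prop) (G : sgraph) : Prop :=
  forall H : sgraph, F H -> heavy H G.

Definition pair_family (R S : sgraph) : sgraph -> Prop :=
  fun H => H = R \/ H = S.

(* The graph on {0, ..., n - 1} with the given edges: entries are unordered
   pairs, and loops or pairs with a component >= n are ignored. *)
Section EdgeList.
Variables (n : nat) (E : seq (nat * nat)).

Definition edge_adj : rel 'I_n := fun i j =>
  (i != j) && (((val i, val j) \in E) || ((val j, val i) \in E)).

Lemma edge_adj_sym : symmetric edge_adj.
Proof. by move=> i j; rewrite /edge_adj eq_sym orbC. Qed.

Lemma edge_adj_irr : irreflexive edge_adj.
Proof. by move=> i; rewrite /edge_adj eqxx. Qed.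

Definition edge_graph : sgraph := SGraph edge_adj_sym edge_adj_irr.

End EdgeList.

Definition path_edges (n : nat) : seq (nat * nat) :=
  [seq (i, i.+1) | i <- iota 0 n.-1].

Definition P (n : nat) : sgraph := edge_graph n (path_edges n).

Definition triangle_edges : seq (nat * nat) := [:: (0, 1); (1, 2); (0, 2)].

Definition C3 : sgraph := edge_graph 3 triangle_edges.

Definition K13 : sgraph := edge_graph 4 [:: (0, 1); (0, 2); (0, 3)].

(* Triangle 0, 1, 2 with the path 2, 3, ..., i + 2 hanging from vertex 2. *)
Definition Z (i : nat) : sgraph :=
  edge_graph (i + 3) ((0, 2) :: path_edges (i + 3)).

Definition bull : sgraph :=
  edge_graph 5 (triangle_edges ++ [:: (0, 3); (1, 4)]).

Definition net : sgraph :=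
  edge_graph 6 (triangle_edges ++ [:: (0, 3); (1, 4); (2, 5)]).

Definition wounded : sgraph :=
  edge_graph 6 (triangle_edges ++ [:: (0, 3); (1, 4); (4, 5)]).

Definition claw_and_partner (R S : sgraph) : Prop :=
  isomorphic R K13 /\
  (isomorphic S (P 4) \/ isomorphic S (P 5) \/ isomorphic S C3 \/
   isomorphic S (Z 1) \/ isomorphic S (Z 2) \/ isomorphic S bull \/
   isomorphic S net \/ isomorphic S wounded).

(* Main.v *)
(* A nonadjacent pair of degree sum at least n can be used on a cycle like an
   edge (Bondy-Chvatal).  Fix a longest cycle and a shortest path P outside it
   between two of its vertices o and o'.  Around o, grow an arc U of the cycle:
   absorb the next vertex on a side when it has a second neighbour in U, and both
   next vertices when they are adjacent.  Inside U all reroutings needed for the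
   exchange arguments at o survive, so U never meets an arc grown at o'.  If the
   arcs at o and at o' both stop at a nonadjacent pair of large degree sum, these
   two pairs yield a longer cycle.  Otherwise one of the arcs, with its two
   neighbours on the cycle and the first vertex of P attached, has no such pair,
   hence no claw, and three pendant vertices: it contains a net, and also a
   wounded unless the three attachments form a triangle.  In that case P
   continues the triangle to a wounded, or o is adjacent to the second vertex of
   P, or these two have a large degree sum, which counting neighbours around the
   cycle excludes.  Conversely, six small nonhamiltonian graphs leave no other
   pair; the last of them is there for P6. *)

Require Import Defs.
From Stdlib Require Import Classical_Prop.
From mathcomp Require Import all_boot zify.

Set Implicit Arguments.
Unset Strict Implicit.
Unset Printing Implicit Defensive.

(** * Ore cycles *)

Lemma crossing_count (T : Type) (a b : pred T) x s :
  (forall s1 z s2, s = s1 ++ z :: s2 -> ~~ (a (last x s1) && b z)) ->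
  count a (belast x s) + count b s <= size s.
Proof.
elim: s x => [|y s IH] x //= H.
have H0 := H [::] y s erefl; rewrite /= in H0.
have := IH y (fun s1 z s2 E => H (y :: s1) z s2 (congr1 (cons y) E)).
by move: H0; case: (a x); case: (b y) => //=; lia.
Qed.

Section Ore.
Variable G : sgraph.
Implicit Types (x y z u v w : G) (c s : seq G).

Definition ore : rel G :=
  fun x y => (x != y) && (adj x y || (#|G| <= deg x + deg y)).

Lemma ore_sym : symmetric ore.
Proof. by move=> x y; rewrite /ore eq_sym adj_sym addnC. Qed.

Lemma ore_irr : irreflexive ore.
Proof. by move=> x; rewrite /ore eqxx. Qed.

Lemma adj_neq x y : adj x y -> x != y.
Proof. by apply: contraTN => /eqP ->; rewrite adj_irr. Qed.

Lemma adj_ore x y : adj x y -> ore x y.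
Proof. by move=> xy; rewrite /ore adj_neq ?xy. Qed.

Lemma ore_light x y : x != y -> ~~ ore x y -> deg x + deg y < #|G|.
Proof. by rewrite /ore => ->; rewrite negb_or -ltnNge => /andP[]. Qed.

Lemma ore_heavy x y : ore x y -> ~~ adj x y -> #|G| <= deg x + deg y.
Proof. by case/andP=> _ /orP[->|]. Qed.

Definition out c u := [set w | adj u w & w \notin c].

Lemma card_seq c : uniq c -> #|[set w in c]| = size c.
Proof. by move=> Uc; rewrite cardsE; apply/card_uniqP. Qed.

Lemma deg_count c u : uniq c -> deg u = count (adj u) c + #|out c u|.
Proof.
move=> Uc; rewrite /deg -(cardsID [set w in c]); congr (_ + _).
  rewrite -size_filter -(card_seq (filter_uniq _ Uc)).
  by apply: eq_card => w; rewrite !inE mem_filter.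
by apply: eq_card => w; rewrite !inE andbC.
Qed.

Lemma size_outside c : uniq c -> #|[set w | w \notin c]| + size c = #|G|.
Proof.
move=> Uc; rewrite -(card_seq Uc) addnC -cardsT -(cardsID [set w in c] setT).
by rewrite setTI; congr (_ + _); apply: eq_card => w; rewrite !inE andbT.
Qed.

Definition gaps x s := count id (pairmap (fun y z => ~~ adj y z) x s).

Lemma gaps_cat x s1 s2 : gaps x (s1 ++ s2) = gaps x s1 + gaps (last x s1) s2.
Proof. by rewrite /gaps pairmap_cat count_cat. Qed.

Lemma gaps_cons x y s : gaps x (y :: s) = ~~ adj x y + gaps y s.
Proof. by []. Qed.

Lemma gaps_rcons x s z : gaps x (rcons s z) = gaps x s + ~~ adj (last x s) z.
Proof. by rewrite -cats1 gaps_cat /gaps /= addn0. Qed.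

Lemma gaps_rev x s : gaps (last x s) (rev (belast x s)) = gaps x s.
Proof.
elim: s x => [|y s IH] x //=.
rewrite rev_cons gaps_rcons IH addnC /gaps /=; congr (nat_of_bool _ + _).
case: s IH => [|z s] IH //=; first by rewrite adj_sym.
by rewrite rev_cons last_rcons adj_sym.
Qed.

Lemma path_failure (e e' : rel G) x s : path e x s -> ~~ path e' x s ->
  exists s1 z s2, s = s1 ++ z :: s2 /\ ~~ e' (last x s1) z.
Proof.
elim: s x => [|y s IH] x //= /andP[_ es].
rewrite negb_and => /orP[N|/(IH _ es)[s1 [z [s2 [-> N]]]]].
  by exists [::], y, s.
by exists (y :: s1), z, s2.
Qed.

(* Bondy-Chvatal: a non-edge of degree sum at least n on an Ore cycle is
   removed either by a common neighbour off the cycle or by a crossing. *)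
Lemma ore_cycle c : uniq c -> 2 < size c -> cycle ore c ->
  exists c', [/\ uniq c', cycle (@adj G) c' & size c <= size c'].
Proof.
have gapsle d : forall v s, gaps v (rcons s v) <= d -> uniq (v :: s) ->
    2 < size (v :: s) -> path ore v (rcons s v) ->
    exists c', [/\ uniq c', cycle (@adj G) c' & size (v :: s) <= size c'].
  elim: d => [|d IH] v0 s0 gd U0 sz0 C0;
    (have [H|H] := boolP (path (@adj G) v0 (rcons s0 v0)); first by exists (v0 :: s0)).
    have [s1 [z [s2 [E N]]]] := path_failure C0 H.
    by move: gd; rewrite E gaps_cat /gaps /= N; lia.
  have [s1 [v [s2 [E N]]]] := path_failure C0 H.
  have [s [U sz Es gE [C Nuv]]] : exists s, [/\ uniq (v :: s), 2 < size (v :: s),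
      size (v :: s) = size (v0 :: s0), gaps v (rcons s v) = gaps v0 (rcons s0 v0)
      & path ore v (rcons s v) /\ ~~ adj (last v s) v].
    case/lastP: s2 E => [|s2 w].
      by rewrite cats1 => /rcons_inj[E Ew]; subst; exists s1.
    rewrite -rcons_cons -rcons_cat => /rcons_inj[E Ew]; subst w s0.
    have Es : size (v :: s2 ++ v0 :: s1) = size (v0 :: s1 ++ v :: s2).
      by rewrite /= !size_cat /=; lia.
    exists (s2 ++ v0 :: s1); split => //.
    - by rewrite -cat_cons uniq_catC.
    - by rewrite Es.
    - by rewrite !gaps_rcons !gaps_cat !gaps_cons !last_cat /=; lia.
    - rewrite last_cat; split=> //; move: C0.
      rewrite !rcons_path !cat_path !last_cat /=.
      by case/andP=> /and3P[-> -> ->] ->.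
  rewrite -Es; move: gd C Nuv; rewrite -gE !gaps_rcons rcons_path => gd /andP[C oe] Nuv.
  rewrite Nuv in gd.
  have hv := ore_heavy oe Nuv.
  pose u := last v s.
  have [/existsP[w /and3P[wc uw vw]]|Ncom] :=
    boolP [exists w, [&& w \notin v :: s, adj u w & adj v w]].
    have [||||c' [Uc' Cc' sc']] := IH w (v :: s).
    - by rewrite rcons_cons gaps_cons gaps_rcons adj_sym vw uw addn0; rewrite addn1 in gd.
    - by rewrite cons_uniq wc.
    - exact: leqW.
    - by rewrite /= rcons_path C !adj_ore // adj_sym.
    by exists c'; split=> //; apply: leq_trans sc'.
  have [s1' [z [s2' [E' /andP[a1 a2]]]]] : exists s1 z s2,
    s = s1 ++ z :: s2 /\ adj u (last v s1) && adj v z.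
    have [/existsP[i /andP[a1 a2]]|Nsplit] := boolP [exists i : 'I_(size s),
        adj u (last v (take i s)) && adj v (nth v s i)].
      exists (take i s), (nth v s i), (drop i.+1 s).
      by rewrite -drop_nth // cat_take_drop a1.
    have cnt : count (adj u) (belast v s) + count (adj v) s <= size s.
      apply: crossing_count => t1 z t2 Et; apply: contra Nsplit => azz.
      have lt1 : size t1 < size s by rewrite Et size_cat /= -addSnnS leq_addr.
      apply/existsP; exists (Ordinal lt1) => /=.
      by rewrite Et take_size_cat // nth_cat ltnn subnn.
    have out_le : #|out (v :: s) u| + #|out (v :: s) v| <= #|[set w | w \notin v :: s]|.
      rewrite -cardsUI [X in _ + X](_ : _ = 0) ?addn0.
        by apply/subset_leq_card/subsetP => w; rewrite !inE => /orP[] /andP[].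
      apply: eq_card0 => w; rewrite !inE; apply/negP => /andP[/andP[uw wc] /andP[vw _]].
      by move/negP: Ncom; apply; apply/existsP; exists w; rewrite wc uw.
    have := size_outside U; have := deg_count u U; have := deg_count v U.
    have -> : count (adj u) (v :: s) = count (adj u) (belast v s).
      by rewrite lastI -cats1 count_cat /= -/u adj_irr !addn0.
    by move: hv out_le cnt; rewrite /= adj_irr -/u; clear; lia.
  have ule : last z s2' = u by rewrite /u E' last_cat.
  have perm_c : perm_eq (v :: s1' ++ rev (z :: s2')) (v :: s).
    by rewrite E' perm_cons perm_cat2l perm_rev.
  have szc := perm_size perm_c.
  have lrev : forall y, last y (rev (z :: s2')) = z by move=> y; rewrite rev_cons last_rcons.
  have revE : rev (z :: s2') = u :: rev (belast z s2').
    by rewrite [in LHS]lastI rev_rcons ule.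
  have [||||c' [Uc' Cc' sc']] := IH v (s1' ++ rev (z :: s2')).
  - move: gd; rewrite E' gaps_rcons gaps_cat last_cat lrev [adj z v]adj_sym a2 addn0.
    rewrite gaps_cat gaps_cons revE gaps_cons [adj _ u]adj_sym a1 -{1}ule gaps_rev.
    by rewrite addn1 ltnS; apply: leq_trans; rewrite leq_add2l leq_addl.
  - by rewrite (perm_uniq perm_c).
  - by rewrite szc.
  - rewrite rcons_path last_cat lrev cat_path [ore z v]ore_sym [ore v z]adj_ore // andbT.
    move: C; rewrite E' cat_path /= => /and3P[-> /= _ Cz].
    rewrite revE /= ore_sym adj_ore //= -ule rev_path.
    by apply: sub_path Cz => ? ?; rewrite ore_sym.
  by exists c'; split=> //; rewrite -szc.
case: c => // v s U sz C; exact: gapsle (leqnn _) U sz C.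
Qed.
End Ore.
Arguments ore {G}.

(** * Spanning paths and links *)

Ltac perm_count :=
  let f := fresh "f" in
  apply/permP => f;
  repeat match goal with H : is_true (perm_eq _ _) |- _ => move/permP: H => /(_ f) end;
  rewrite -?cats1; do 3 rewrite ?(count_cat, count_rev) /=; clear; lia.

Section Linkage.
Variables (T : eqType) (e : rel T).
Hypothesis e_sym : symmetric e.
Implicit Types (x y z w o a b p q u v : T) (s t S : seq T).

Definition pth x y s :=
  if s is z :: s' then [&& x == z, path e z s' & last z s' == y] else false.

Lemma pth1 x : pth x x [:: x].
Proof. by rewrite /= !eqxx. Qed.

Lemma pth_cat x y z w s t : pth x y s -> e y z -> pth z w t -> pth x w (s ++ t).
Proof.
case: s t => [|x' s] [|z' t] //= /and3P[-> Ps /eqP <-] yz /and3P[/eqP<- Pt Lt].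
by rewrite cat_path last_cat /= Ps yz Pt.
Qed.

Lemma pth_rcons x y z s : pth x y s -> e y z -> pth x z (rcons s z).
Proof. by rewrite -cats1 => Ps yz; apply: pth_cat Ps yz (pth1 z). Qed.

Lemma pth_cons x y z s : pth x y s -> e z x -> pth z y (z :: s).
Proof. by move=> Ps zx; apply: pth_cat (pth1 z) zx Ps. Qed.

Lemma pth_rev x y s : pth x y s -> pth y x (rev s).
Proof.
elim: s x => // z [|u s] IH x /and3P[/eqP-> /= Ps /eqP Ls].
  by rewrite /= -Ls !eqxx.
case/andP: Ps => zu Ps; rewrite rev_cons; apply: pth_rcons; last by rewrite e_sym; exact: zu.
by apply: IH; rewrite /= eqxx Ps Ls eqxx.
Qed.

Lemma pth_cycle x y s : pth x y s -> e y x -> cycle e s.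
Proof. by case: s => //= z s /and3P[/eqP-> Ps /eqP<-] yz; rewrite rcons_path Ps. Qed.

Lemma pth_mem x y s : pth x y s -> x \in s /\ y \in s.
Proof.
by case: s => //= z s /and3P[/eqP-> _ /eqP<-]; rewrite mem_head mem_last.
Qed.

Lemma pth_split x y z s t : pth x y (s ++ z :: t) ->
  pth x z (rcons s z) /\ pth z y (z :: t).
Proof.
case: s => [|u s] /= /and3P[/eqP-> Ps Ls]; first by rewrite !eqxx Ps.
move: Ps Ls; rewrite cat_path last_cat last_rcons rcons_path /= !eqxx /=.
by case/and3P=> -> -> -> ->.
Qed.

Definition spanp S x y := exists s, pth x y s /\ perm_eq s S.

Definition link S x y z w :=
  exists s t, [/\ pth x y s, pth z w t & perm_eq (s ++ t) S].

Lemma spanp_grow S S' x y p : spanp S x y -> e y p -> perm_eq (p :: S) S' ->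
  spanp S' x p.
Proof.
case=> s [Ps pS] yp pS'; exists (rcons s p); split; first exact: pth_rcons Ps yp.
by perm_count.
Qed.

Lemma link_sym S x y z w : link S x y z w -> link S z w x y.
Proof. by case=> s [t [Ps Pt pS]]; exists t, s; split=> //; perm_count. Qed.

Lemma link_rev2 S x y z w : link S x y z w -> link S x y w z.
Proof.
by case=> s [t [Ps Pt pS]]; exists s, (rev t); split; rewrite ?pth_rev //; perm_count.
Qed.

Lemma link_grow S S' x y z w p : link S x y z w -> e w p -> perm_eq (p :: S) S' ->
  link S' x y z p.
Proof.
case=> s [t [Ps Pt pS]] wp pS'; exists s, (rcons t p); split=> //; first exact: pth_rcons wp.
by perm_count.
Qed.

Lemma link_growl S S' x y z w p : link S x y z w -> e y p -> perm_eq (p :: S) S' ->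
  link S' x p z w.
Proof. by move=> /link_sym L yp pS'; apply/link_sym/(link_grow L yp). Qed.

Lemma link_new S S' x y p : spanp S x y -> perm_eq (p :: S) S' -> link S' x y p p.
Proof. by case=> s [Ps pS] pS'; exists s, [:: p]; rewrite pth1; split=> //; perm_count. Qed.

Lemma link_join S S' x y z w p : link S x y z w -> e y p -> e p z ->
  perm_eq (p :: S) S' -> spanp S' x w.
Proof.
case=> s [t [Ps Pt pS]] yp pz pS'; exists (s ++ p :: t); split; last by perm_count.
exact: pth_cat Ps yp (pth_cons Pt pz).
Qed.

Lemma link_disjoint S x y z w u v : uniq S -> link S x y z w ->
  u \in [:: x; y] -> v \in [:: z; w] -> u != v.
Proof.
move=> US [s [t [Ps Pt pS]]] us vt; apply/negP => /eqP E; subst v.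
have [[xs ys] [zt wt]] := (pth_mem Ps, pth_mem Pt).
have us' : u \in s by move: us; rewrite !inE => /orP[] /eqP->.
have ut' : u \in t by move: vt; rewrite !inE => /orP[] /eqP->.
move: US; rewrite -(perm_uniq pS) cat_uniq => /and3P[_ /hasP[]].
by exists u.
Qed.

(* A part S of a cycle with three exits: o to a path outside the cycle, a and b
   along the cycle.  The last two clauses say that any s other than b (resp. a),
   together with b (resp. a), is linked to the other two exits by two disjoint
   paths spanning S. *)
Definition good S o a b :=
  [/\ spanp S o a, spanp S o b,
      (forall v, v \in S -> v != b -> link S o v a b \/ link S o b v a)
    & (forall v, v \in S -> v != a -> link S o v a b \/ link S o a v b)].

Lemma good1 o : good [:: o] o o o.
Proof.
by split; [exists [:: o]; rewrite pth1 | exists [:: o]; rewrite pth1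
  | move=> s; rewrite inE => -> | move=> s; rewrite inE => ->].
Qed.

Lemma good_sym S o a b : good S o a b -> good S o b a.
Proof.
case=> sa sb Lb La; split=> // s sS ns.
  by have [/link_rev2|] := La s sS ns; [left | right].
by have [/link_rev2|] := Lb s sS ns; [left | right].
Qed.

Lemma good_grow S S' o a b p v : good S o a b -> perm_eq (p :: S) S' ->
  e b p -> e p v -> v \in S -> v != b -> good S' o a p.
Proof.
case=> sa sb Lb La pS' bp ps sS sb'; move: v ps sS sb' => s ps sS sb'.
have bp' := bp; have ps' := ps; rewrite e_sym in bp'; rewrite e_sym in ps'.
have mS' u : u \in S' -> u = p \/ u \in S.
  by rewrite -(perm_mem pS') inE => /orP[/eqP|]; [left | right].
split.
- have [L|L] := Lb s sS sb'.
    by apply: (link_join (link_rev2 L) ps' _ pS'); rewrite e_sym.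
  by apply: (link_join L bp ps pS').
- exact: spanp_grow sb bp pS'.
- move=> t /mS'[->|tS]; first by rewrite eqxx.
  move=> tp; have [->|tb] := eqVneq t b.
    have [L|L] := Lb s sS sb'.
      by right; apply: (link_growl (link_rev2 L) ps' pS').
    by left; apply: (link_grow (link_rev2 L) ps' pS').
  have [L|L] := Lb t tS tb; first by left; apply: (link_grow L bp pS').
  by right; apply: (link_growl L bp pS').
- move=> t /mS'[->|tS] ta; first by right; apply: link_new sa pS'.
  by have [L|L] := La t tS ta; [left|right]; apply: (link_grow L bp pS').
Qed.

Lemma good_grow2 S S' o a b p q : good S o a b -> perm_eq (p :: q :: S) S' ->
  e b p -> e a q -> e p q -> good S' o q p.
Proof.
case=> sa sb Lb La pS' bp aq pq.
have qp := pq; rewrite e_sym in qp.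
have pS0 u : perm_eq (u :: S) (u :: S) by [].
have pS1 : perm_eq (q :: p :: S) S'.
  by perm_count.
have mS' u : u \in S' -> [\/ u = p, u = q | u \in S].
  by rewrite -(perm_mem pS') !inE => /or3P[/eqP|/eqP|]; [constructor 1|constructor 2|constructor 3].
split.
- by apply: spanp_grow (spanp_grow sb bp (pS0 p)) pq pS1.
- by apply: spanp_grow (spanp_grow sa aq (pS0 q)) qp pS'.
- move=> t /mS'[->|->|tS]; first by rewrite eqxx.
    by right; apply: link_new (spanp_grow sb bp (pS0 p)) pS1.
  move=> tp; have [->|tb] := eqVneq t b.
    left; case: sb => s [Ps ps]; exists s, [:: q; p]; split=> //; last by perm_count.
    by rewrite /= !eqxx qp.
  have [L|L] := Lb t tS tb.
    left; apply: link_rev2 (link_grow (link_rev2 (link_grow L bp (pS0 p))) aq pS1).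
  right; apply: (link_grow (link_growl L bp (pS0 p)) aq pS1).
- move=> t /mS'[->|->|tS]; last first.
  - move=> tp; have [->|tb] := eqVneq t a.
      left; case: sa => s [Ps ps]; exists s, [:: q; p]; split=> //; last by perm_count.
      by rewrite /= !eqxx qp.
    have [L|L] := La t tS tb.
      left; apply: link_rev2 (link_grow (link_rev2 (link_grow L bp (pS0 p))) aq pS1).
    right; apply: (link_grow (link_growl L aq (pS0 q)) bp pS').
  - by rewrite eqxx.
  by right; apply: link_new (spanp_grow sa aq (pS0 q)) pS'.
Qed.

End Linkage.

(** * Growing an arc of a longest cycle *)

Section Theta.
Variable G : sgraph.
Implicit Types (U A V B P c s : seq G) (a b o p q x y z u v : G).

Local Notation apth := (pth (@adj G)).
Local Notation pth := (pth (@ore G)).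
Local Notation spanp := (spanp (@ore G)).
Local Notation link := (link (@ore G)).
Local Notation good := (good (@ore G)).

Lemma pth_adj x y s : apth x y s -> pth x y s.
Proof.
case: s => //= z s /and3P[-> Ps ->]; rewrite andbT /=.
by apply: sub_path Ps => ? ?; apply: adj_ore.
Qed.

(* The cycle is U A V B in cyclic order, P is a path outside it from o in U
   to o' in V; each part comes with its end vertices. *)
Record theta U a o b A p q' V a' o' b' B p' q P x y : Prop := Theta {
  th_U : apth a b U;
  th_bp : adj b p;
  th_A : apth p q' A;
  th_qa' : adj q' a';
  th_V : apth a' b' V;
  th_bp' : adj b' p';
  th_B : apth p' q B;
  th_qa : adj q a;
  th_P : apth x y P;
  th_ox : adj o x;
  th_yo : adj y o';
  th_o : o \in U;
  th_o' : o' \in V;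
  th_uniq : uniq (U ++ A ++ V ++ B ++ P);
  th_max : forall c, uniq c -> cycle ore c -> size c <= size (U ++ A ++ V ++ B)
}.

Section Conf.
Variables (U A V B P : seq G) (a o b p q' a' o' b' p' q x y : G).
Hypothesis T : theta U a o b A p q' V a' o' b' B p' q P x y.

Lemma theta_rev : theta (rev U) b o a (rev B) q p' (rev V) b' o' a' (rev A) q' p P x y.
Proof.
case: T => ? ? ? ? ? ? ? ? ? ? ? ? ? Un Mx; split; rewrite ?mem_rev //;
  try by [apply: pth_rev => //; apply: adj_sym | rewrite adj_sym].
  by rewrite (perm_uniq (_ : perm_eq _ (U ++ A ++ V ++ B ++ P))) //; perm_count.
move=> c Uc Cc.
have E : perm_eq (rev U ++ rev B ++ rev V ++ rev A) (U ++ A ++ V ++ B) by perm_count.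
by rewrite (perm_size E) Mx.
Qed.

Lemma theta_swap : theta V a' o' b' B p' q U a o b A p q' (rev P) y x.
Proof.
case: T => ? ? ? ? ? ? ? ? ? ? ? ? ? Un Mx; split; rewrite ?mem_rev //;
  try by [apply: pth_rev => //; apply: adj_sym | rewrite adj_sym].
  by rewrite (perm_uniq (_ : perm_eq _ (U ++ A ++ V ++ B ++ P))) //; perm_count.
move=> c Uc Cc; have E : perm_eq (V ++ B ++ U ++ A) (U ++ A ++ V ++ B) by perm_count.
by rewrite (perm_size E) Mx.
Qed.

Lemma no_long c r : cycle ore c -> perm_eq (c ++ r) (U ++ A ++ V ++ B ++ P) ->
  size r < size P -> False.
Proof.
move=> Cc pc szr; have := th_uniq T; rewrite -(perm_uniq pc) cat_uniq.
case/and3P=> Uc _ _; have := th_max T Uc Cc; have := perm_size pc.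
rewrite !size_cat; move: szr; clear.
by move: (size c) (size r) (size U) (size A) (size V) (size B) (size P); lia.
Qed.

Lemma P_gt0 : 0 < size P.
Proof. by have := th_P T; case: (P). Qed.

Lemma no_span c : cycle ore c -> perm_eq c (U ++ A ++ V ++ B ++ P) -> False.
Proof. by move=> Cc pc; apply: (no_long (r := [::]) Cc); rewrite ?cats0 ?P_gt0. Qed.

Let hA := pth_adj (th_A T).
Let hV := pth_adj (th_V T).
Let hB := pth_adj (th_B T).
Let hP := pth_adj (th_P T).
Let hbp := adj_ore (th_bp T).
Let hqa' := adj_ore (th_qa' T).
Let hbp' := adj_ore (th_bp' T).
Let hqa := adj_ore (th_qa T).
Let hox := adj_ore (th_ox T).
Let hyo := adj_ore (th_yo T).
Let osym := @ore_sym G.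

Let orient u v : ore u v -> ore v u. Proof. by rewrite ore_sym. Qed.

Let prev := pth_rev osym.

(* The suffixes m, p and 0 tell how a vertex u of a part is linked: u to b and
   o to a, u to a and o to b, or u to o and a to b.  In ore_pm, ore_p0, ore_px
   and ore_qx the first letter stands for the vertex p or q of theta. *)
Lemma ore_mm u v : link U o a u b -> link V o' a' v b' -> ~~ ore u v.
Proof.
case=> s1 [s2 [Ps1 Ps2 ps]] [t1 [t2 [Pt1 Pt2 pt]]]; apply/negP => uv.
apply: (@no_span (rev s1 ++ P ++ t1 ++ rev A ++ rev s2 ++ t2 ++ B)); last by perm_count.
apply: pth_cycle hqa; apply: pth_cat (prev Ps1) hox _; apply: pth_cat hP hyo _.
apply: pth_cat Pt1 (orient hqa') _; apply: pth_cat (prev hA) (orient hbp) _.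
by apply: pth_cat (prev Ps2) uv (pth_cat Pt2 hbp' hB).
Qed.

Lemma ore_0m u v : link U o u a b -> link V o' a' v b' -> ~~ ore u v.
Proof.
case=> s1 [s2 [Ps1 Ps2 ps]] [t1 [t2 [Pt1 Pt2 pt]]]; apply/negP => uv.
apply: (@no_span (rev s1 ++ P ++ t1 ++ rev A ++ rev s2 ++ rev B ++ rev t2)); last by perm_count.
apply: pth_cycle (orient uv); apply: pth_cat (prev Ps1) hox _; apply: pth_cat hP hyo _.
apply: pth_cat Pt1 (orient hqa') _; apply: pth_cat (prev hA) (orient hbp) _.
apply: pth_cat (prev Ps2) (orient hqa) _.
by apply: pth_cat (prev hB) (orient hbp') (prev Pt2).
Qed.

Lemma ore_pm v : spanp U o a -> link V o' a' v b' -> ~~ ore p v.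
Proof.
case=> s [Ps ps] [t1 [t2 [Pt1 Pt2 pt]]]; apply/negP => pv.
apply: (@no_span (rev s ++ P ++ t1 ++ rev A ++ t2 ++ B)); last by perm_count.
apply: pth_cycle hqa; apply: pth_cat (prev Ps) hox _; apply: pth_cat hP hyo _.
apply: pth_cat Pt1 (orient hqa') _; apply: pth_cat (prev hA) pv _.
exact: pth_cat Pt2 hbp' hB.
Qed.

Lemma ore_p0 v : spanp U o a -> link V o' v a' b' -> ~~ ore p v.
Proof.
case=> s [Ps ps] [t1 [t2 [Pt1 Pt2 pt]]]; apply/negP => pv.
apply: (@no_span (rev s ++ P ++ t1 ++ A ++ t2 ++ B)); last by perm_count.
apply: pth_cycle hqa; apply: pth_cat (prev Ps) hox _; apply: pth_cat hP hyo _.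
apply: pth_cat Pt1 (orient pv) _; apply: pth_cat hA hqa' _.
exact: pth_cat Pt2 hbp' hB.
Qed.

Lemma ore_px z : spanp U o a -> z \in P -> ~~ ore p z.
Proof.
case=> s [Ps ps] zP; apply/negP => pz.
have [P1 [P2 EP]] : exists P1 P2, P = P1 ++ z :: P2.
  by case/splitPr: zP => P1 P2; exists P1, P2.
have := hP; rewrite EP => Pz.
have [Pz1 _] := pth_split Pz.
apply: (@no_long (rev s ++ rcons P1 z ++ A ++ V ++ B) P2); last 1 first.
- by rewrite EP size_cat /= addnS ltnS leq_addl.
- apply: pth_cycle hqa; apply: pth_cat (prev Ps) hox _.
  apply: pth_cat Pz1 (orient pz) _; apply: pth_cat hA hqa' _.
  exact: pth_cat hV hbp' hB.
- by rewrite EP; perm_count.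
Qed.
Lemma shift_p p1 p2 A3 : A = p1 :: p2 :: A3 -> p1 = p /\
  theta (rcons U p) a o p (p2 :: A3) p2 q' V a' o' b' B p' q P x y.
Proof.
case: T => tU tbp tA tqa' tV tbp' tB tqa tP tox tyo to to' Un Mx EA.
rewrite EA in tA Un Mx; case/and3P: tA => /eqP E /= /andP[pp2 PA] LA; subst p1.
split=> //; split=> //.
- exact: pth_rcons tU tbp.
- by rewrite /= eqxx PA.
- by rewrite mem_rcons inE to orbT.
- by rewrite cat_rcons.
- by rewrite cat_rcons.
Qed.

Lemma absorb_p : spanp V o' b' -> spanp (rcons U p) o a ->
  exists A2 p2, A = p :: A2 /\
    theta (rcons U p) a o p A2 p2 q' V a' o' b' B p' q P x y.
Proof.
case=> t [Pt pt] [s [Ps ps]].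
case EA: A => [|p1 [|p2 A3]]; first by have := th_A T; rewrite EA.
  have E : p = p1 by have := th_A T; rewrite EA => /and3P[/eqP].
  subst p1; case: (@no_span (rev s ++ P ++ t ++ B)).
    apply: pth_cycle hqa; apply: pth_cat (prev Ps) hox _; apply: pth_cat hP hyo _.
    exact: pth_cat Pt hbp' hB.
  by rewrite EA; perm_count.
by have [-> T2] := shift_p EA; exists (p2 :: A3), p2.
Qed.

Lemma absorb_pq_size : spanp U o b -> spanp V o' b' -> ore p q ->
  exists p2 A3, A = p :: p2 :: A3.
Proof.
case=> s [Ps ps] [t [Pt pt]] pq.
case EA: A => [|p1 [|p2 A3]]; first by have := th_A T; rewrite EA.
  have E : p = p1 by have := th_A T; rewrite EA => /and3P[/eqP].
  subst p1; case: (@no_span (s ++ p :: rev B ++ rev t ++ rev P)).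
    apply: (pth_cycle (x := o) (y := x)); last by rewrite ore_sym.
    apply: pth_cat Ps hbp _; rewrite -cat1s; apply: pth_cat (pth1 _ _) pq _.
    apply: pth_cat (prev hB) (orient hbp') _.
    exact: pth_cat (prev Pt) (orient hyo) (prev hP).
  by rewrite EA; perm_count.
by have [-> _] := shift_p EA; exists p2, A3.
Qed.

End Conf.

Section Conf2.
Variables (U A V B P : seq G) (a o b p q' a' o' b' p' q x y : G).
Hypothesis T : theta U a o b A p q' V a' o' b' B p' q P x y.

Lemma absorb_q : spanp V o' a' -> spanp (q :: U) o b ->
  exists B2 q2, B = rcons B2 q /\
    theta (q :: U) q o b A p q' V a' o' b' B2 p' q2 P x y.
Proof.
move=> sV [s [Ps ps]]; have sV' : spanp (rev V) o' a'.
  by case: sV => t [Pt pt]; exists t; split=> //; perm_count.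
have [|A2 [p2 [EB T2]]] := absorb_p (theta_rev T) sV'.
  by exists s; split=> //; perm_count.
exists (rev A2), p2; split; first by rewrite -[B]revK EB rev_cons.
by have := theta_rev T2; rewrite !revK rev_rcons revK.
Qed.

Lemma absorb_pq : spanp U o a -> spanp U o b -> spanp V o' a' -> spanp V o' b' ->
  ore p q ->
  exists A2 p2 B2 q2, [/\ A = p :: A2, B = rcons B2 q &
    theta (q :: rcons U p) q o p A2 p2 q' V a' o' b' B2 p' q2 P x y].
Proof.
move=> sa sb sa' sb' pq; have [p2 [A3 EA]] := absorb_pq_size T sb sb' pq.
have rsp S u v : spanp S u v -> spanp (rev S) u v.
  by case=> s [? ?]; exists s; split=> //; perm_count.
have qp : ore q p by rewrite ore_sym.
have [q2 [B3 EB]] := absorb_pq_size (theta_rev T) (rsp _ _ _ sa) (rsp _ _ _ sa') qp.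
have [_ T1] := shift_p T EA; have [_ T2] := shift_p (theta_rev T1) EB.
exists (p2 :: A3), p2, (rev (q2 :: B3)), q2; split=> //.
  by rewrite -[B]revK EB rev_cons.
by have := theta_rev T2; rewrite !revK rev_rcons revK.
Qed.

Lemma ore_pp u v : link U o b u a -> link V o' b' v a' -> ~~ ore u v.
Proof.
move=> Lu Lv; apply: (ore_mm (theta_rev T)).
  by case: Lu => s1 [s2 [? ? ?]]; exists s1, s2; split=> //; perm_count.
by case: Lv => s1 [s2 [? ? ?]]; exists s1, s2; split=> //; perm_count.
Qed.

Lemma ore_0p u v : link U o u a b -> link V o' b' v a' -> ~~ ore u v.
Proof.
move=> /link_rev2 Lu Lv; apply: (ore_0m (theta_rev T)).
  by case: (Lu (@ore_sym G)) => s1 [s2 [? ? ?]]; exists s1, s2; split=> //; perm_count.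
by case: Lv => s1 [s2 [? ? ?]]; exists s1, s2; split=> //; perm_count.
Qed.

Lemma ore_qx z : spanp U o b -> z \in P -> ~~ ore q z.
Proof.
case=> s [Ps ps]; apply: (ore_px (theta_rev T)).
by exists s; split=> //; perm_count.
Qed.

End Conf2.

Lemma theta_disj U A V B P a o b p q' a' o' b' p' q x y u v :
  theta U a o b A p q' V a' o' b' B p' q P x y -> u \in U -> v \in V -> u != v.
Proof.
move=> T uU vV; apply/negP => /eqP E; have := th_uniq T.
rewrite cat_uniq => /and3P[_ /hasP[]]; exists u => //.
by rewrite E !mem_cat vV orbT.
Qed.

Definition conflict U o a b := exists u v, #|G| <= deg u + deg v /\
  [\/ link U o a u b /\ link U o b v a,
      link U o a u b /\ link U o v a b
    | link U o b u a /\ link U o v a b].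

Lemma link_mem U u v w z : link U u v w z ->
  [/\ u \in U, v \in U, w \in U & z \in U].
Proof.
case=> s [t [/pth_mem[us vs] /pth_mem[wt zt] pS]].
by rewrite -!(perm_mem pS) !mem_cat us vs wt zt !orbT.
Qed.

(* Of the two sums deg u + deg w and deg v + deg z at least one is >= n, and
   likewise for deg u + deg z and deg v + deg w; the kinds of links rule out
   both edges of one of these matchings. *)
Lemma no_two_conflicts U A V B P a o b p q' a' o' b' p' q x y :
  theta U a o b A p q' V a' o' b' B p' q P x y ->
  conflict U o a b -> conflict V o' a' b' -> False.
Proof.
move=> T [u [v [huv Cuv]]] [w [z [hwz Cwz]]]; have S := theta_swap T.
have mm (s t : G) : link U o a s b -> link V o' a' t b' -> deg s + deg t < #|G|.
  move=> L1 L2; apply: ore_light; last exact: (ore_mm T L1 L2).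
  by case: (link_mem L1) (link_mem L2) => _ _ m _ [_ _ m' _]; exact: (theta_disj T m m').
have pp (s t : G) : link U o b s a -> link V o' b' t a' -> deg s + deg t < #|G|.
  move=> L1 L2; apply: ore_light; last exact: (ore_pp T L1 L2).
  by case: (link_mem L1) (link_mem L2) => _ _ m _ [_ _ m' _]; exact: (theta_disj T m m').
have m0 (s t : G) : link U o s a b -> link V o' a' t b' -> deg s + deg t < #|G|.
  move=> L1 L2; apply: ore_light; last exact: (ore_0m T L1 L2).
  by case: (link_mem L1) (link_mem L2) => _ m _ _ [_ _ m' _]; exact: (theta_disj T m m').
have p0 (s t : G) : link U o s a b -> link V o' b' t a' -> deg s + deg t < #|G|.
  move=> L1 L2; apply: ore_light; last exact: (ore_0p T L1 L2).
  by case: (link_mem L1) (link_mem L2) => _ m _ _ [_ _ m' _]; exact: (theta_disj T m m').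
have m0' (s t : G) : link U o a s b -> link V o' t a' b' -> deg t + deg s < #|G|.
  move=> L1 L2; apply: ore_light; last exact: (ore_0m S L2 L1).
  by case: (link_mem L2) (link_mem L1) => _ m _ _ [_ _ m' _]; exact: (theta_disj S m m').
have p0' (s t : G) : link U o b s a -> link V o' t a' b' -> deg t + deg s < #|G|.
  move=> L1 L2; apply: ore_light; last exact: (ore_0p S L2 L1).
  by case: (link_mem L2) (link_mem L1) => _ m _ _ [_ _ m' _]; exact: (theta_disj S m m').
have fin (h1 : deg u + deg w < #|G|) (h2 : deg v + deg z < #|G|) : False.
  by move: huv hwz h1 h2; clear; lia.
have fin' (h1 : deg u + deg z < #|G|) (h2 : deg v + deg w < #|G|) : False.
  by move: huv hwz h1 h2; clear; lia.
have sw (s t : G) : deg s + deg t < #|G| -> deg t + deg s < #|G| by rewrite addnC.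
case: Cuv Cwz => [[Lu Lv]|[Lu Lv]|[Lu Lv]] [[Lw Lz]|[Lw Lz]|[Lw Lz]];
  first [ by apply: fin; first [exact: mm | exact: pp | exact: m0 | exact: p0
                               | apply: sw; first [exact: m0' | exact: p0']]
        | by apply: fin'; first [exact: mm | exact: pp | exact: m0 | exact: p0
                               | apply: sw; first [exact: m0' | exact: p0']]].
Qed.

Definition clean U := {in U &, forall u v, ore u v -> adj u v}.

Definition detached P U o := forall z u, z \in P -> u \in U -> u != o -> ~~ ore z u.

Definition free U a b p q :=
  [/\ forall u, u \in U -> u != b -> ~~ ore p u,
      forall u, u \in U -> u != a -> ~~ ore q u & ~~ ore p q].

Lemma theta_p U A V B P a o b p q' a' o' b' p' q x y :
  theta U a o b A p q' V a' o' b' B p' q P x y -> p \notin U /\ q \notin U.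
Proof.
move=> T; have := th_uniq T; rewrite cat_uniq => /and3P[_ /hasPn N _].
have [pA _] := pth_mem (th_A T); have [_ qB] := pth_mem (th_B T).
by split; apply: N; rewrite !mem_cat ?pA ?qB ?orbT.
Qed.

Lemma clean_cons U p b : clean U -> ore b p -> adj b p ->
  (forall u, u \in U -> u != b -> ore p u -> adj p u) -> clean (p :: U).
Proof.
move=> cU _ bp H u v; rewrite !inE => /orP[/eqP->|uU] /orP[/eqP->|vU].
- by rewrite ore_irr.
- by have [->|nv] := eqVneq v b; [rewrite adj_sym | apply: H].
- by rewrite ore_sym adj_sym; have [->|nv] := eqVneq u b; [rewrite adj_sym | apply: H].
exact: cU.
Qed.

Lemma growth U A V B P a o b p q' a' o' b' p' q x y :
  theta U a o b A p q' V a' o' b' B p' q P x y ->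
  good U o a b -> good V o' a' b' -> clean U -> detached P U o ->
  exists U1 a1 b1 A1 p1 B1 q1,
    [/\ theta U1 a1 o b1 A1 p1 q' V a' o' b' B1 p' q1 P x y, good U1 o a1 b1,
        perm_eq (U1 ++ A1 ++ V ++ B1) (U ++ A ++ V ++ B)
      & [/\ clean U1, detached P U1 o & free U1 a1 b1 p1 q1] \/ conflict U1 o a1 b1].
Proof.
have [m] := ubnP (size A + size B).
elim: m => // m IH in U A B a b p q * => szm T gU gV cU dU.
have [sa sb Lb La] := gU; have [sa' sb' _ _] := gV.
have [pU qU] := theta_p T.
match goal with |- ?goal =>
  have step U2 A2 B2 a2 b2 p2 q2 : theta U2 a2 o b2 A2 p2 q' V a' o' b' B2 p' q2 P x y ->
    good U2 o a2 b2 -> perm_eq (U2 ++ A2 ++ V ++ B2) (U ++ A ++ V ++ B) ->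
    size A2 + size B2 < m -> clean U2 -> detached P U2 o -> goal end.
  move=> T2 g2 pS2 sz2 c2 d2; have := IH _ _ _ _ _ _ _ sz2 T2 g2 gV c2 d2.
  case=> [U3 [a3 [b3 [A3 [p3 [B3 [q3 [T3 g3 p3' H3]]]]]]]].
  exists U3, a3, b3, A3, p3, B3, q3; split=> //; exact: perm_trans p3' pS2.
have bp := th_bp T; have qa := th_qa T.
have aq : ore a q by rewrite ore_sym adj_ore.
have bp' := adj_ore bp.
have gp u : u \in U -> u != b -> ore p u -> good (rcons U p) o a p.
  move=> uU ub pu; apply: (good_grow (@ore_sym G) gU _ bp' pu) => //.
  by rewrite perm_sym perm_rcons.
have gq u : u \in U -> u != a -> ore q u -> good (q :: U) o q b.
  move=> uU ua qu; apply: (good_sym (@ore_sym G)).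
  by apply: (good_grow (@ore_sym G) (good_sym (@ore_sym G) gU) (perm_refl _) aq qu).
have dp : detached P (p :: U) o.
  move=> z u zP; rewrite inE => /orP[/eqP-> _|]; last exact: dU.
  by rewrite ore_sym; apply: (ore_px T).
have dq W : detached P W o -> detached P (q :: W) o.
  move=> dW z u zP; rewrite inE => /orP[/eqP-> _|]; last exact: dW.
  by rewrite ore_sym; apply: (ore_qx T).
have [Hp|/hasPn Hp] := boolP (has (fun u => (u != b) && ore p u) U).
  have [u0 u0U /andP[u0b pu0]] := hasP Hp.
  have gU1 := gp _ u0U u0b pu0; have [sa1 _ Lb1 _] := gU1.
  have [A2 [p2 [EA T1]]] := absorb_p T sb' sa1.
  have [/hasP[u uU /and3P[ub pu Npu]]|/hasPn Np] :=
    boolP (has (fun u => [&& u != b, ore p u & ~~ adj p u]) U).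
    exists (rcons U p), a, p, A2, p2, B, q; split=> //; first by rewrite EA cat_rcons.
    right; exists p, u.
    split; first exact: ore_heavy pu Npu.
    have Lp : link (rcons U p) o a p p.
      by apply: link_new sa _; rewrite perm_sym perm_rcons.
    have up : u != p by apply: contraNneq pU => <-.
    by have [|L|L] := Lb1 u _ up; [rewrite mem_rcons inE uU orbT|constructor 2|constructor 1].
  have pS : perm_eq (rcons U p ++ A2 ++ V ++ B) (U ++ A ++ V ++ B) by rewrite EA cat_rcons.
  apply: (step _ _ _ _ _ _ _ T1 gU1 pS); first by move: szm; rewrite EA /= addSn ltnS.
    have /= c1 : clean (p :: U).
      apply: clean_cons cU bp' bp _ => u uU ub pu; apply: contraTT (Np u uU) => Npu.
      by rewrite ub pu Npu.
    by move=> u v; rewrite !mem_rcons; apply: c1.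
  by move=> z u zP; rewrite mem_rcons; apply: dp.
have [Hq|/hasPn Hq] := boolP (has (fun u => (u != a) && ore q u) U).
  have [u0 u0U /andP[u0a qu0]] := hasP Hq.
  have gU1 := gq _ u0U u0a qu0; have [_ sb1 _ La1] := gU1.
  have [B2 [q2 [EB T1]]] := absorb_q T sa' sb1.
  have [/hasP[u uU /and3P[ua qu Nqu]]|/hasPn Nq] :=
    boolP (has (fun u => [&& u != a, ore q u & ~~ adj q u]) U).
    have Lq : link (q :: U) o b q q by apply: link_new sb _.
    have uq : u != q by apply: contraNneq qU => <-.
    exists (q :: U), q, b, A, p, B2, q2; split=> //.
      by rewrite EB -cats1; apply/permP => f; rewrite /= !count_cat /=; clear; lia.
    right.
    have [|L|L] := La1 u _ uq; first by rewrite inE uU orbT.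
      by exists q, u; split; [exact: ore_heavy qu Nqu|constructor 3].
    by exists u, q; split; [rewrite addnC; exact: ore_heavy qu Nqu|constructor 1].
  have pS : perm_eq ((q :: U) ++ A ++ V ++ B2) (U ++ A ++ V ++ B).
    by rewrite EB -cats1; apply/permP => f; rewrite /= !count_cat /=; clear; lia.
  apply: (step _ _ _ _ _ _ _ T1 gU1 pS _ _ (dq _ dU)).
    by move: szm; rewrite EB size_rcons addnS ltnS.
  apply: (clean_cons cU aq); first by rewrite adj_sym.
  move=> u uU ua qu; apply: contraTT (Nq u uU) => Nqu.
  by rewrite ua qu Nqu.
have [pq|Npq] := boolP (ore p q); last first.
  exists U, a, b, A, p, B, q; split=> //; left; split=> //; split=> // u uU un.
    by have := Hp u uU; rewrite un.
  by have := Hq u uU; rewrite un.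
have [A2 [p2 [B2 [q2 [EA EB T1]]]]] := absorb_pq T sa sb sa' sb' pq.
have pS1 : perm_eq (p :: q :: U) (q :: rcons U p).
  by rewrite -cats1; apply/permP => f; rewrite /= count_cat /=; clear; lia.
have pS2 : perm_eq ((q :: rcons U p) ++ A2 ++ V ++ B2) (U ++ A ++ V ++ B).
  by rewrite EA EB -!cats1; apply/permP => f; rewrite /= !count_cat /= !count_cat /=; clear; lia.
have gU1 := good_grow2 (@ore_sym G) gU pS1 bp' aq pq.
have [apq|Napq] := boolP (adj p q); last first.
  exists (q :: rcons U p), q, p, A2, p2, B2, q2; split=> //; right; exists p, q.
  split; first exact: ore_heavy pq Napq.
  constructor 1; split.
    by apply: link_new (spanp_grow sa aq (perm_refl _)) pS1.
  apply: link_new (spanp_grow sb bp' (perm_refl _)) _.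
  by rewrite perm_cons perm_sym perm_rcons.
apply: (step _ _ _ _ _ _ _ T1 gU1 pS2).
- by move: szm; rewrite EA EB size_rcons /= addnS ltnS addSn; apply: ltnW.
- have c1 : clean (p :: U).
    apply: clean_cons cU bp' bp _ => u uU ub pu.
    by have := Hp u uU; rewrite ub pu.
  have c2 : clean (q :: p :: U).
    have qp : ore q p by rewrite ore_sym.
    have aqp : adj p q by [].
    move=> u v; rewrite [u \in _]in_cons [v \in _]in_cons.
    move=> /orP[/eqP->|uU] /orP[/eqP->|vU]; last exact: c1.
    + by rewrite ore_irr.
    + move: vU; rewrite inE => /orP[/eqP->|vU]; first by rewrite adj_sym.
      have [->|va] := eqVneq v a => // qv; by have := Hq v vU; rewrite va qv.
    + move: uU; rewrite inE => /orP[/eqP->//|uU]; rewrite ore_sym adj_sym.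
      have [->|ua] := eqVneq u a => // qu; by have := Hq u uU; rewrite ua qu.
  by move=> u v; rewrite !(inE, mem_rcons) => ? ?; apply: c2; rewrite !inE.
- by move=> z u zP; rewrite inE mem_rcons => uU; apply: (dq _ dp) => //; rewrite inE.
Qed.

End Theta.

(** * Nets from shortest paths *)

Section Copies.
Variable G : sgraph.
Implicit Types (x y z u v : G) (s t : seq G).

Definition edge_in (E : seq (nat * nat)) i j := ((i, j) \in E) || ((j, i) \in E).

Definition apart x y := (x != y) && ~~ ore x y.

Lemma apart_sym x y : apart x y = apart y x.
Proof. by rewrite /apart eq_sym ore_sym. Qed.

Definition fits E i j x y := if edge_in E i j then adj x y else apart x y.

Fixpoint fits_row E i j x s :=
  if s is y :: s' then fits E i j x y && fits_row E i j.+1 x s' else true.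

(* s, read from index i on, spans a copy of the graph with edge list E in
   which no two nonadjacent vertices have degree sum at least n. *)
Fixpoint light_copy E i s :=
  if s is x :: s' then fits_row E i i.+1 x s' && light_copy E i.+1 s' else true.

Lemma fits_rowP E i j x s x0 : fits_row E i j x s ->
  forall k, k < size s -> fits E i (j + k) x (nth x0 s k).
Proof.
elim: s j => [|y s IH] j //= /andP[F /IH{}IH] [|k] lek; first by rewrite addn0.
by rewrite -addSnnS IH.
Qed.

Lemma light_copyP E i s x0 : light_copy E i s ->
  forall j k, j < k < size s -> fits E (i + j) (i + k) (nth x0 s j) (nth x0 s k).
Proof.
elim: s i => [|x s IH] i; first by move=> _ j k; rewrite andbF.
move=> /andP[F /IH{}IH] [|j] [|k] //=; first last.
- by rewrite !ltnS -!addSnnS => jk; apply: IH.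
by rewrite ltnS addn0 -addSnnS; apply: fits_rowP.
Qed.

Lemma no_light_copy n E s : heavy (edge_graph n E) G -> 0 < n -> size s = n ->
  light_copy E 0 s -> False.
Proof.
case: s => [|x0 s'] hE n0 sz; first by rewrite -sz in n0.
set s := x0 :: s' in sz * => /(@light_copyP E 0 s x0); rewrite /= => L.
have Lw j k : j < k < n -> fits E j k (nth x0 s j) (nth x0 s k) by rewrite -sz => /L.
have Lneq j k : j < k < n -> nth x0 s j != nth x0 s k.
  by move=> /Lw; rewrite /fits; case: ifP => _; [apply: adj_neq | case/andP].
have Us : uniq s.
  apply/(uniqP x0) => j k; rewrite !inE sz => jn kn E'; have [jk|jk|//] := ltngtP j k.
    by move: (Lneq j k); rewrite jk kn E' eqxx => /(_ isT).
  by move: (Lneq k j); rewrite jk jn E' eqxx => /(_ isT).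
have Ladj j k : j < n -> k < n ->
    adj (nth x0 s j) (nth x0 s k) = (j != k) && edge_in E j k.
  move=> jn kn; wlog jk : j k jn kn / j <= k.
    move=> H; have [le|/ltnW le] := leqP j k; first exact: H.
    by rewrite adj_sym eq_sym /edge_in orbC; apply: H.
  have [->|ne] := eqVneq j k; first by rewrite adj_irr.
  have := Lw j k; rewrite ltn_neqAle ne jk kn => /(_ isT); rewrite /fits.
  by case: ifP => // _ /andP[? /(contra (@adj_ore _ _ _))/negbTE].
case: (hE [set x in s]).
  have inP (g : induced [set x in s]) : val g \in s by have := valP g; rewrite inE.
  have ixP (g : induced [set x in s]) : index (val g) s < n by rewrite -sz index_mem inP.
  exists (fun g => Ordinal (ixP g) : edge_graph n E); split.
    apply: inj_card_bij.
      move=> g g' /(congr1 val) /= /(congr1 (nth x0 s)).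
      by rewrite !nth_index ?inP //; apply: val_inj.
    by rewrite card_ord card_sig cardsE (card_uniqP Us) sz.
  move=> g g'; rewrite -[RHS]/(adj (val g) (val g')).
  by rewrite -{2}(nth_index x0 (inP g)) -{2}(nth_index x0 (inP g')) Ladj ?ixP.
move=> u [v []]; rewrite !in_set => us vs uv Nuv hv.
have nuv : ~~ ore u v.
  have iu : index u s < n by rewrite -sz index_mem.
  have iv : index v s < n by rewrite -sz index_mem.
  have : index u s != index v s.
    by apply: contraNneq uv => E'; rewrite -(nth_index x0 us) E' nth_index.
  case: ltngtP => // ji _.
    have := Lw (index u s) (index v s); rewrite ji iv !nth_index // => /(_ isT).
    by rewrite /fits (negbTE Nuv); case: ifP => // _ /andP[].
  have := Lw (index v s) (index u s); rewrite ji iu !nth_index // => /(_ isT).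
  by rewrite /fits adj_sym (negbTE Nuv) ore_sym; case: ifP => // _ /andP[].
by move: nuv; rewrite /ore uv (negbTE Nuv) hv.
Qed.
End Copies.

Section Shortest.
Variables (T : finType) (e : rel T) (D tgt : pred T).
Implicit Types (x : T) (s : seq T).

Definition walk x s := [&& path e x s, all D (x :: s) & tgt (last x s)].

Lemma shortest x s0 : walk x s0 ->
  exists2 s, walk x s & forall s', walk x s' -> size s <= size s'.
Proof.
move=> w0; pose has_walk n := [exists t : n.-tuple T, walk x t].
have ex : exists n, has_walk n.
  by exists (size s0); apply/existsP; exists (in_tuple s0).
case: (ex_minnP ex) => n /existsP[t wt] min; exists t => // s' ws'.
by rewrite size_tuple; apply: min; apply/existsP; exists (in_tuple s').
Qed.

Variables (x : T) (s : seq T).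
Hypotheses (ws : walk x s) (min : forall s', walk x s' -> size s <= size s').
Let t i := nth x (x :: s) i.

Lemma walk_all i : i <= size s -> D (t i).
Proof.
by case/and3P: ws => _ aD _ le; apply: (allP aD); rewrite mem_nth.
Qed.

Lemma walk_step i : i < size s -> e (t i) (t i.+1).
Proof. by case/and3P: ws => /(pathP x)/(_ i) + _ _; apply. Qed.

Lemma last_take i : i <= size s -> last x (take i s) = t i.
Proof.
case: i => [|i] lei; first by rewrite take0.
by rewrite (last_nth x) size_takel //= /t /= nth_take.
Qed.

Lemma shortest_tgt i : i < size s -> ~~ tgt (t i).
Proof.
move=> lti; apply/negP => ti; have := min (s' := take i s).
rewrite size_takel ?(ltnW lti) // leqNgt lti; suff -> : walk x (take i s) by move/(_ isT).
case/and3P: ws => Ps aD _; apply/and3P; split; last by rewrite last_take // ltnW.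
  exact: take_path.
by move: aD => /= /andP[-> /allP aD]; apply/allP => y /mem_take/aD.
Qed.

Lemma shortest_splice i j : i <= size s -> j <= size s -> path e (t i) (drop j s) ->
  last (t i) (drop j s) = last x s -> j <= i.
Proof.
move=> lei lej Pd Ld; have := min (s' := take i s ++ drop j s).
case/and3P: (ws) => Ps aD Ts.
have -> : walk x (take i s ++ drop j s).
  apply/and3P; split; last by rewrite last_cat last_take // Ld.
    by rewrite cat_path take_path // last_take.
  move: aD => /= /andP[-> /allP aD]; apply/allP => y.
  by rewrite mem_cat => /orP[/mem_take|/mem_drop] /aD.
move=> /(_ isT); rewrite size_cat size_takel // size_drop; move: lej; clear.
by move: (size s); lia.
Qed.

Lemma shortest_uniq i j : i < j <= size s -> t i != t j.
Proof.
case/andP=> ij js; apply/negP => /eqP E.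
have := @shortest_splice i j (leq_trans (ltnW ij) js) js; rewrite E leqNgt ij => H.
have Pj : path e (t j) (drop j s).
  by case/and3P: ws => Ps _ _; move: Ps;
    rewrite -{1}(cat_take_drop j s) cat_path last_take // => /andP[].
suff : false by []; apply: H => //.
by rewrite -{2}(cat_take_drop j s) last_cat last_take.
Qed.

Lemma shortest_induced i j : i.+1 < j <= size s -> ~~ e (t i) (t j).
Proof.
case/andP=> ij js; apply/negP => E; case: j ij js E => // j ij js E.
have lei : i <= size s by apply: leq_trans js; apply: leqW; apply: ltnW.
have := @shortest_splice i j lei (ltnW js); rewrite leqNgt -ltnS ij => H.
suff : false by []; apply: H.
  rewrite (drop_nth x js) /= -/(t j.+1) E.
  case/and3P: ws => Ps _ _; move: Ps;
    rewrite -{1}(cat_take_drop j.+1 s) cat_path last_take // => /andP[].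
by [].
rewrite (drop_nth x js) /= -[nth x s j]/(t j.+1) -{2}(cat_take_drop j.+1 s) last_cat last_take //.
Qed.

End Shortest.

Definition net_edges := triangle_edges ++ [:: (0, 3); (1, 4); (2, 5)].
Definition wounded_edges := triangle_edges ++ [:: (0, 3); (1, 4); (4, 5)].

Section NetCopy.
Variable G : sgraph.
Implicit Types t u v : G.

Lemma net_copy t0 t1 t2 t3 t4 t5 :
  adj t0 t1 -> adj t1 t2 -> adj t0 t2 -> adj t0 t3 -> adj t1 t4 -> adj t2 t5 ->
  apart t0 t4 -> apart t0 t5 -> apart t1 t3 -> apart t1 t5 -> apart t2 t3 ->
  apart t2 t4 -> apart t3 t4 -> apart t3 t5 -> apart t4 t5 ->
  light_copy net_edges 0 [:: t0; t1; t2; t3; t4; t5].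
Proof. by rewrite /light_copy /fits_row /fits /=; do 15 move=> ->. Qed.

Lemma wounded_copy t0 t1 t2 t3 t4 t5 :
  adj t0 t1 -> adj t1 t2 -> adj t0 t2 -> adj t0 t3 -> adj t1 t4 -> adj t4 t5 ->
  apart t0 t4 -> apart t0 t5 -> apart t1 t3 -> apart t1 t5 -> apart t2 t3 ->
  apart t2 t4 -> apart t2 t5 -> apart t3 t4 -> apart t3 t5 ->
  light_copy wounded_edges 0 [:: t0; t1; t2; t3; t4; t5].
Proof. by rewrite /light_copy /fits_row /fits /=; do 15 move=> ->. Qed.

End NetCopy.

Section Net.
Variables (G : sgraph) (U : seq G) (a b o x p q : G).
Let K := [:: x, p, q & U].
Hypothesis cK : {in K &, forall u v : G, ore u v -> adj u v}.
Hypothesis claw : forall c u v w : G, adj c u -> adj c v -> adj c w ->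
  u != v -> u != w -> v != w -> [|| ore u v, ore u w | ore v w].
Hypotheses (bp : adj b p) (aq : adj a q) (ox : adj o x).
Hypothesis Np : forall u, u \in U -> u != b -> ~~ ore p u.
Hypothesis Nq : forall u, u \in U -> u != a -> ~~ ore q u.
Hypothesis Nx : forall u, u \in U -> u != o -> ~~ ore x u.
Hypotheses (Npq : ~~ ore p q) (Nxp : ~~ ore x p) (Nxq : ~~ ore x q).
Hypotheses (pU : p \notin U) (qU : q \notin U) (xU : x \notin U).
Hypotheses (xp : x != p) (xq : x != q) (pq : p != q).
Hypotheses (aU : a \in U) (bU : b \in U) (oU : o \in U).
Hypothesis UP : pth (@adj G) a b U.
Hypothesis oa : exists2 s, path (@adj G) o s & all (mem U) s /\ last o s = a.

Let Nadj (u v : G) : ~~ ore u v -> ~~ adj u v.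
Proof. exact: contra (@adj_ore _ _ _). Qed.

Let clawK (c u v w : G) : c \in K -> u \in K -> v \in K -> w \in K ->
  adj c u -> adj c v -> adj c w -> u != v -> u != w -> v != w ->
  [|| adj u v, adj u w | adj v w].
Proof.
move=> cK' uK vK wK cu cv cw uv uw vw.
by have /or3P[/cK->//|/cK->//|/cK->//] := claw cu cv cw uv uw vw; rewrite ?orbT.
Qed.

Let UK (u : G) : u \in U -> u \in K. Proof. by move=> uU; rewrite !inE uU !orbT. Qed.
Let xK : x \in K. Proof. by rewrite !inE eqxx. Qed.

(* Join p and q by a shortest path L through U, and x to L by a shortest path
   F: as there is no claw, the last vertex of F sees exactly two consecutive
   vertices of L. *)
Lemma light_net : exists s : seq G, [/\ size s = 6, light_copy net_edges 0 s &
  (exists2 t : seq G, size t = 6 & light_copy wounded_edges 0 t)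
  \/ [/\ adj o a, adj o b & adj a b]].
Proof.
pose W := [:: p, q & U].
have WK (u : G) : u \in W -> u \in K by move=> uW; rewrite inE uW orbT.
have WxE (u : G) : u \in W -> x != u.
  by rewrite !inE => /or3P[/eqP->|/eqP->|uU] //; apply: contraNneq xU => ->.
have [sL wL minL] : exists2 s, walk (@adj G) (mem W) (pred1 p) q s &
    forall s', walk (@adj G) (mem W) (pred1 p) q s' -> size s <= size s'.
  apply: (@shortest _ _ _ _ _ (rcons U p)); apply/and3P; split.
  - case: U UP => //= z s /and3P[/eqP<- Ps /eqP Ls].
    by rewrite adj_sym aq rcons_path Ps Ls.
  - apply/allP => u; rewrite !inE mem_rcons inE orbA [(u == q) || _]orbC -orbA.
    by [].
  - by rewrite last_rcons /= eqxx.
pose l i := nth q (q :: sL) i; pose M := size sL.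
have lW i : i <= M -> l i \in W by apply: (walk_all wL).
have lK i : i <= M -> l i \in K by move/lW/WK.
have lS i : i < M -> adj (l i) (l i.+1) by apply: (walk_step wL).
have lU i j : i < j <= M -> l i != l j by apply: (shortest_uniq wL minL).
have lI i j : i.+1 < j <= M -> ~~ adj (l i) (l j) by apply: (shortest_induced wL minL).
have l0 : l 0 = q by [].
have lM : l M = p by case/and3P: wL => _ _ /eqP <-; rewrite (last_nth q).
have nbrq (u : G) : u \in K -> adj q u -> u = a.
  rewrite !inE => /or4P[/eqP->|/eqP->|/eqP->|uU].
  - by rewrite adj_sym (negbTE (Nadj Nxq)).
  - by rewrite adj_sym (negbTE (Nadj Npq)).
  - by rewrite adj_irr.
  by move=> qu; apply/eqP; apply: contraTT qu => ua; apply/Nadj/Nq.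
have nbrp (u : G) : u \in K -> adj p u -> u = b.
  rewrite !inE => /or4P[/eqP->|/eqP->|/eqP->|uU].
  - by rewrite adj_sym (negbTE (Nadj Nxp)).
  - by rewrite adj_irr.
  - by rewrite (negbTE (Nadj Npq)).
  by move=> qu; apply/eqP; apply: contraTT qu => ua; apply/Nadj/Np.
have nbrx (u : G) : u \in K -> adj x u -> u = o.
  rewrite !inE => /or4P[/eqP->|/eqP->|/eqP->|uU].
  - by rewrite adj_irr.
  - by rewrite (negbTE (Nadj Nxp)).
  - by rewrite (negbTE (Nadj Nxq)).
  by move=> qu; apply/eqP; apply: contraTT qu => ua; apply/Nadj/Nx.
have M0 : 0 < M by rewrite lt0n; apply: contraNneq pq => E; rewrite -lM E.
have l1 : l 1 = a by apply: nbrq; [apply: lK | rewrite -l0; apply: lS].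
have lM1 : l M.-1 = b.
  by apply: nbrp; [apply/lK/leq_pred | rewrite adj_sym -lM -{2}(prednK M0); apply/lS;
    rewrite prednK].
pose tgt := [pred z : G | has (adj z) (q :: sL)].
have tgtP (z : G) i : i <= M -> adj z (l i) -> tgt z.
  by move=> iM zi; apply/hasP; exists (l i) => //; rewrite mem_nth.
have xtgt : ~~ tgt x.
  apply/hasP => -[u /(nthP q)[i iM <-{u}]]; rewrite -/(l i) ltnS -/M in iM * => xi.
  have Eo : l i = o := nbrx _ (lK _ iM) xi.
  case: i iM xi Eo => [|i] iM xi Eo; first by move: qU; rewrite -l0 Eo oU.
  have [EM|nM] := eqVneq i.+1 M; first by move: pU; rewrite -lM -EM Eo oU.
  have i2 : i.+2 <= M by rewrite ltn_neqAle nM iM.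
  have c1 : adj (l i.+1) (l i) by rewrite adj_sym lS.
  have c2 : adj (l i.+1) (l i.+2) by apply: lS.
  have c3 : adj (l i.+1) x by rewrite adj_sym.
  have n1 : l i != l i.+2 by apply: lU; rewrite i2 leqnSn.
  have n2 : l i != x by rewrite eq_sym; apply/WxE/lW/ltnW.
  have n3 : l i.+2 != x by rewrite eq_sym; apply/WxE/lW.
  have := clawK (lK _ iM) (lK _ (ltnW iM)) (lK _ i2) xK c1 c2 c3 n1 n2 n3.
  rewrite (negbTE (lI _ _ _)) ?i2 ?ltnSn //= => /orP[] H.
    move: (nbrx _ (lK _ (ltnW iM))); rewrite adj_sym H => /(_ isT) Ei.
    by have := @lU i i.+1; rewrite ltnSn iM Ei Eo eqxx => /(_ isT).
  move: (nbrx _ (lK _ i2)); rewrite adj_sym H => /(_ isT) Ei.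
  by have := @lU i.+1 i.+2; rewrite ltnSn i2 Ei Eo eqxx => /(_ isT).
have [sF wF minF] : exists2 s, walk (@adj G) (mem (x :: U)) tgt x s &
    forall s', walk (@adj G) (mem (x :: U)) tgt x s' -> size s <= size s'.
  case: oa => s Ps [aU' Ls]; apply: (@shortest _ _ _ _ _ (o :: s)); apply/and3P; split.
  - by rewrite /= adj_sym ox.
  - rewrite /= !inE eqxx oU orbT /=; apply/allP => u /(allP aU') uU.
    by rewrite !inE; move: uU => /= ->; rewrite orbT.
  - by apply: (tgtP _ 0) => //=; rewrite Ls.
pose f i := nth x (x :: sF) i; pose k := size sF.
have fW i : i <= k -> f i \in x :: U by apply: (walk_all wF).
have fK i : i <= k -> f i \in K.
  by move/fW; rewrite inE => /orP[/eqP->//|/UK].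
have fS i : i < k -> adj (f i) (f i.+1) by apply: (walk_step wF).
have fU i j : i < j <= k -> f i != f j by apply: (shortest_uniq wF minF).
have fI i j : i.+1 < j <= k -> ~~ adj (f i) (f j) by apply: (shortest_induced wF minF).
have fT i : i < k -> ~~ tgt (f i) by apply: (shortest_tgt wF minF).
have ftgt : tgt (f k) by case/and3P: wF => _ _; rewrite (last_nth x).
have f0 : f 0 = x by [].
have k0 : 0 < k by rewrite lt0n; apply: contraNneq xtgt => E; rewrite -f0 -E.
have fadj i j : i < k -> j <= M -> ~~ adj (f i) (l j).
  by move=> ik jM; apply: contra (fT i ik) => /(tgtP _ _ jM).
have fneq i j : i <= k -> j <= M -> f i != l j.
  case: i => [|i] ik jM; first by apply/WxE/lW.
  by apply: contraTneq (fS i ik) => ->; apply: fadj.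
have fkU : f k \in U.
  have := fW k (leqnn k); rewrite inE => /orP[/eqP E|//].
  by have := @fU 0 k; rewrite k0 leqnn f0 E eqxx => /(_ isT).
have end0 : ~~ adj (f k) (l 0).
  rewrite adj_sym; apply/negP => /(nbrq _ (fK _ (leqnn k))) E.
  by have := @fneq k 1 (leqnn k) M0; rewrite l1 E eqxx.
have endM : ~~ adj (f k) (l M).
  rewrite lM adj_sym; apply/negP => /(nbrp _ (fK _ (leqnn k))) E.
  by have := @fneq k M.-1 (leqnn k) (leq_pred M); rewrite lM1 E eqxx.
have [i [iM a1 a2]] : exists i, [/\ i.+2 < M, adj (f k) (l i.+1) & adj (f k) (l i.+2)].
  have [j [jM b1 b2]] : exists j, [/\ j < M, adj (f k) (l j) & adj (f k) (l j.+1)].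
    case/hasP: ftgt => u /(nthP q)[j jM <-{u}]; rewrite -/(l j) => kj.
    rewrite ltnS -/M in jM.
    have jnM : j != M by apply: contraNneq endM => <-.
    case: j jM kj jnM => [|j] jM kj jnM; first by rewrite kj in end0.
    have j2 : j.+2 <= M by rewrite ltn_neqAle jnM jM.
    have jM' := ltnW jM; have kk := leqnn k.
    have c1 : adj (l j.+1) (l j) by rewrite adj_sym lS.
    have c2 : adj (l j.+1) (l j.+2) by apply: lS.
    have c3 : adj (l j.+1) (f k) by rewrite adj_sym.
    have n1 : l j != l j.+2 by apply: lU; rewrite j2 leqnSn.
    have n2 : l j != f k by rewrite eq_sym fneq.
    have n3 : l j.+2 != f k by rewrite eq_sym fneq.
    have := clawK (lK _ jM) (lK _ jM') (lK _ j2) (fK _ kk) c1 c2 c3 n1 n2 n3.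
    rewrite (negbTE (lI _ _ _)) ?j2 ?ltnSn //= => /orP[] H.
      by exists j; rewrite kj adj_sym H (ltnW j2).
    by exists j.+1; rewrite kj [adj _ (l j.+2)]adj_sym H.
  case: j jM b1 b2 => [|i] jM b1 b2; first by rewrite b1 in end0.
  exists i; split=> //; rewrite ltn_neqAle jM andbT.
  by apply: contraNneq endM => <-.
have [i1M i2M] : i.+1 <= M /\ i.+2 <= M by split; [apply: ltnW (ltnW _) | apply: ltnW].
have i0M : i <= M by apply: ltnW.
have [k' Ek] : exists k', k = k'.+1 by exists k.-1; rewrite prednK.
have kk : k' < k by rewrite Ek.
have kk' : k' <= k by apply: ltnW.
have ffk' : adj (f k) (f k') by rewrite adj_sym Ek; apply: fS; rewrite Ek.
have onlytwo u v : u <= M -> v <= M -> u.+1 < v -> adj (f k) (l u) -> ~~ adj (f k) (l v).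
  move=> uM vM uv au; apply/negP => av.
  have kk0 := leqnn k; have n1 := fneq _ _ kk' uM; have n2 := fneq _ _ kk' vM.
  have n3 : l u != l v by apply: lU; rewrite vM ltnW.
  have := clawK (fK _ kk0) (fK _ kk') (lK _ uM) (lK _ vM) ffk' au av n1 n2 n3.
  by rewrite !(negbTE (fadj _ _ _ _)) // (negbTE (lI _ _ _)) ?uv.
have mk (u v : G) : u \in K -> v \in K -> u != v -> ~~ adj u v -> apart u v.
  by move=> uK vK uv Nuv; rewrite /apart uv; apply: contra Nuv => /(cK uK vK).
have ll u v : u.+1 < v <= M -> apart (l u) (l v).
  move=> /andP[uv vM]; have uM : u <= M by apply: leq_trans vM; apply: ltnW (ltnW uv).
  by apply: mk; rewrite ?lK ?lU ?lI ?vM ?uv ?(ltnW uv).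
have fl u v : u < k -> v <= M -> apart (f u) (l v).
  by move=> uk vM; apply: mk; rewrite ?fK ?lK ?fneq ?fadj // ltnW.
have ff u v : u.+1 < v <= k -> apart (f u) (f v).
  move=> /andP[uv vM]; have uM : u <= k by apply: leq_trans vM; apply: ltnW (ltnW uv).
  by apply: mk; rewrite ?fK ?fU ?fI ?vM ?uv ?(ltnW uv).
have fkl v : v <= M -> v != i.+1 -> v != i.+2 -> apart (f k) (l v).
  move=> vM v1 v2; apply: mk; rewrite ?fK ?lK ?fneq //.
  have [vi|vi] := leqP v i.
    by apply: contraL a2 => av; apply: onlytwo av => //; rewrite !ltnS.
  by apply: onlytwo a1 => //; move: v1 v2 vi; clear; lia.
exists [:: f k; l i.+1; l i.+2; f k'; l i; l i.+3]; split=> //.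
  apply: net_copy => //.
  - exact: lS.
  - by rewrite adj_sym; apply: lS.
  - exact: lS.
  - by apply: fkl => //; rewrite neq_ltn ?ltnS ?leqnn ?leqnSn.
  - by apply: fkl => //; rewrite neq_ltn ?ltnS ?leqnn ?leqnSn ?orbT.
  - by rewrite apart_sym; apply: fl.
  - by apply: ll; rewrite iM ltnSn.
  - by rewrite apart_sym; apply: fl.
  - by rewrite apart_sym; apply: ll; rewrite ltnSn.
  - exact: fl.
  - exact: fl.
  by apply: ll; rewrite iM ltnS leqW.
have [k0'|k0'] := posnP k'; last first.
  left; have [k2 Ek2] : exists k2, k' = k2.+1 by exists k'.-1; rewrite prednK.
  have k2k : k2.+2 <= k by rewrite Ek Ek2.
  exists [:: l i.+1; f k; l i.+2; l i; f k'; f k2] => //.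
  apply: wounded_copy => //; try by rewrite apart_sym; apply: fl => //; apply: ltnW.
  - by rewrite adj_sym.
  - exact: lS.
  - by rewrite adj_sym; apply: lS.
  - by rewrite adj_sym Ek2; apply: fS; apply: ltnW.
  - by apply: fkl => //; rewrite neq_ltn ?ltnS ?leqnn ?leqnSn.
  - by rewrite apart_sym; apply: ff; rewrite leqnn andbT Ek Ek2.
  by rewrite apart_sym; apply: ll; rewrite ltnSn.
have [i0|i0] := posnP i; last first.
  left; have [i' Ei'] : exists i', i = i'.+1 by exists i.-1; rewrite prednK.
  have i'M : i' <= M by apply: leq_trans i0M; rewrite Ei'.
  exists [:: f k; l i.+1; l i.+2; f k'; l i; l i'] => //.
  apply: wounded_copy => //; try (by apply: fl); try by rewrite apart_sym; apply: fl.
  - exact: lS.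
  - by rewrite adj_sym; apply: lS.
  - by rewrite adj_sym Ei'; apply: lS; rewrite -Ei'.
  - by apply: fkl => //; rewrite neq_ltn ?ltnS ?leqnn ?leqnSn.
  - by apply: fkl => //; rewrite Ei' neq_ltn ?ltnS ?leqnn ?leqnSn ?(leqW (leqnSn _)).
  - by rewrite apart_sym; apply: ll; rewrite Ei' -Ei' i1M andbT Ei' ltnSn.
  - by rewrite apart_sym; apply: ll; rewrite ltnSn.
  by rewrite apart_sym; apply: ll; rewrite i2M Ei' ltnS leqW.
have [iM3|iM3] := ltnP i.+3 M.
  left; exists [:: f k; l i.+2; l i.+1; f k'; l i.+3; l i.+4] => //.
  apply: wounded_copy => //; try (by apply: fl); try by rewrite apart_sym; apply: fl.
  - by rewrite adj_sym; apply: lS.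
  - exact: lS.
  - exact: lS.
  - by apply: fkl => //; rewrite neq_ltn ?ltnS ?leqnn ?leqnSn ?orbT.
  - by apply: fkl => //; rewrite neq_ltn ?ltnS ?leqnn ?leqnSn ?orbT ?(leqW (leqnSn _)) ?orbT.
  - by apply: ll; rewrite iM3 ltnSn.
  - by apply: ll; rewrite iM ltnSn.
  by apply: ll; rewrite iM3 ltnS leqW.
right; have EM : M = i.+3 by apply/eqP; rewrite eqn_leq iM3 iM.
have Eo : f k = o.
  by apply: nbrx; [apply: fK | rewrite adj_sym; move: ffk'; rewrite k0' f0].
have E2 : l i.+2 = b by rewrite -lM1 EM.
by rewrite -Eo -E2 -l1 -i0; split=> //; apply: lS.
Qed.

End Net.

(** * Degree sums at the ends of an outside path *)

Section CountGap.
Variables (T : eqType) (c1 c2 : pred T) (m : nat).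
Implicit Types (A G : seq T) (w z : T).

Lemma last_occurrence A : has c1 A -> exists A1 w A2,
  [/\ A = A1 ++ w :: A2, c1 w & ~~ has c1 A2].
Proof.
elim: A => // z A IH /=; have [/IH[A1 [w [A2 [-> w1 N]]]] _|N] := boolP (has c1 A).
  by exists (z :: A1), w, A2.
by rewrite orbF => z1; exists [::], z, A.
Qed.

Lemma first_occurrence A : has c2 A -> exists A1 w A2,
  [/\ A = A1 ++ w :: A2, c2 w & ~~ has c2 A1].
Proof.
elim: A => // z A IH /=; have [z2 _|Nz /= /IH[A1 [w [A2 [-> w2 N]]]]] := boolP (c2 z).
  by exists [::], z, A.
by exists (z :: A1), w, A2; rewrite /= negb_or Nz.
Qed.

(* Positions carrying c1 and later c2 are more than m apart; shifting the
   former by one makes the two sets of positions disjoint, and the gap after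
   the last c1 is missed by both. *)
Lemma count_gap A z0 : 0 < m -> has c1 A -> c2 (last z0 A) -> ~~ c1 (last z0 A) ->
  (forall A1 w G w' A3, A = A1 ++ w :: G ++ w' :: A3 -> c1 w -> c2 w' -> m <= size G) ->
  count c1 A + count c2 A + m <= (size A).+1.
Proof.
move=> m0 /last_occurrence[A1 [w [A2 [-> w1 N1]]]] l2 l1 gap.
have : has c2 A2.
  apply/hasP; exists (last w A2); last by move: l2; rewrite last_cat.
  case: A2 {N1 gap} l1 l2 => [|u A2] /=; last by rewrite mem_last.
  by rewrite last_cat /= w1.
move=> /first_occurrence[G [w' [A3 [EA2 w'2 N2]]]].
have mG : m <= size G by apply: gap w1 w'2; rewrite EA2.
have [c1A2 c2G] : count c1 A2 = 0 /\ count c2 G = 0.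
  by move: N1 N2; rewrite !has_count -!eqn0Ngt => /eqP ? /eqP.
have c2A3 : count c2 A3 <= size A3 by apply: count_size.
have cA1 : count c1 (A1 ++ [:: w]) + count c2 (A1 ++ [:: w]) <= (size A1).+2.
  case E: (A1 ++ [:: w]) => [|u s]; first by case: (A1) E.
  have szs : size s = size A1.
    by have := congr1 size E; rewrite size_cat addn1 /= => -[].
  have cr := @crossing_count _ c1 c2 u s.
  have -> : count c1 (u :: s) = count c1 (belast u s) + c1 (last u s).
    by rewrite lastI -cats1 count_cat /= addn0.
  rewrite -szs; suff : count c1 (belast u s) + count c2 s <= size s.
    by move: (c1 (last u s)) (c2 u); clear; do 2 case=> /=; lia.
  apply: cr => s1 z s2 Es; apply/negP => /andP[z1 z2].
  have := gap (belast u s1) (last u s1) [::] z.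
  have EA : A1 ++ w :: A2 = belast u s1 ++ last u s1 :: [::] ++ z :: s2 ++ A2.
    by rewrite -[LHS]cat_rcons -cats1 E Es -cat_cons lastI cat_rcons -catA.
  by move=> /(_ _ EA z1 z2); rewrite leqn0 => /eqP E0; rewrite E0 in m0.
rewrite EA2 -cat1s catA !count_cat !size_cat /=.
move: cA1 c1A2; rewrite EA2 !count_cat /= c2G => cA1 c1A2.
move: c2A3 mG cA1 c1A2; rewrite w'2; clear.
move: (count c1 A1) (count c2 A1) (count c1 G) (count c2 A3) (count c1 A3).
move: (size A1) (size G) (size A3).
by move: (c1 w) (c2 w) (c1 w'); do 3 case=> /=; lia.
Qed.

End CountGap.

Section Bypass.
Variables (G : sgraph) (o o' p q' p' q x y : G) (A B P : seq G).
Hypothesis T : theta [:: o] o o o A p q' [:: o'] o' o' o' B p' q P x y.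
Hypotheses (pq : ore p q) (pq' : ore q' p').
Local Notation pth := (pth (@ore G)).
Let C := o :: A ++ o' :: B.

Let longest (c : seq G) : uniq c -> cycle ore c -> size c <= size C.
Proof. exact: (th_max T). Qed.

Let UC : uniq C.
Proof.
have := th_uniq T; rewrite -[X in uniq X]/(o :: A ++ o' :: B ++ P).
rewrite -[o' :: B ++ P]/((o' :: B) ++ P) catA -cat_cons cat_uniq -/C.
by case/and3P.
Qed.

Let hA := pth_adj (th_A T).
Let hB := pth_adj (th_B T).
Let op : ore o p := adj_ore (th_bp T).
Let qo : ore q o := adj_ore (th_qa T).
Let qo' : ore q' o' := adj_ore (th_qa' T).
Let op' : ore o' p' := adj_ore (th_bp' T).

Lemma outside_far (z : G) : z \notin C -> adj o z -> ~~ ore p z.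
Proof.
move=> zC oz; apply/negP => pz.
suff : size (z :: C) <= size C by rewrite /= ltnn.
have pc : perm_eq ([:: o] ++ [:: z] ++ A ++ [:: o'] ++ B) (z :: C) by rewrite /C; perm_count.
rewrite -(perm_size pc); apply: longest; first by rewrite (perm_uniq pc) cons_uniq zC.
apply: pth_cycle qo.
apply: pth_cat (pth1 _ _) (adj_ore oz) _; rewrite ore_sym in pz; apply: pth_cat (pth1 _ _) pz _.
by apply: pth_cat hA qo' (pth_cat (pth1 _ _) op' hB).
Qed.

Section Path.
Variables (X : seq G) (x1 y1 : G).
Hypotheses (hX : pth x1 y1 X) (ox1 : ore o x1) (yo' : ore y1 o').
Hypothesis UCX : uniq (C ++ X).

Let X_gt0 : 0 < size X. Proof. by case: X hX. Qed.

Lemma too_long (c : seq G) : uniq c -> cycle ore c -> perm_eq c (C ++ X) -> False.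
Proof.
move=> Uc Cc pc; have := longest Uc Cc; rewrite (perm_size pc) size_cat.
by rewrite -{2}[size C]addn0 leq_add2l leqNgt X_gt0.
Qed.

Lemma gap_bound A1 w S w' A3 : A = A1 ++ w :: S ++ w' :: A3 ->
  adj o w -> adj o' w' -> size X <= size S.
Proof.
move=> EA ow o'w'; pose c := [:: o] ++ X ++ [:: o'] ++ (w' :: A3) ++ B ++ rcons A1 w.
have pc : perm_eq (c ++ S) (C ++ X).
  by rewrite /c /C EA; perm_count.
have Uc : uniq c by move: UCX; rewrite -(perm_uniq pc) cat_uniq => /and3P[].
have Cc : cycle ore c.
  have [wP SP] : pth p w (rcons A1 w) /\ pth w q' (w :: S ++ w' :: A3).
    by apply: pth_split; rewrite -EA.
  have [_ w'P] : _ /\ pth w' q' (w' :: A3) := pth_split (s := w :: S) SP.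
  apply: (pth_cycle (x := o) (y := w)); last by rewrite ore_sym adj_ore.
  apply: pth_cat (pth1 _ _) ox1 _; apply: pth_cat hX yo' _.
  apply: pth_cat (pth1 _ _) (adj_ore o'w') _; apply: pth_cat w'P pq' _.
  by apply: pth_cat hB _ wP; rewrite ore_sym.
have := longest Uc Cc; have := perm_size pc; rewrite !size_cat.
by move: (size c) (size S) (size C) (size X); clear; lia.
Qed.

Lemma exit_far : ~~ adj o q'.
Proof.
apply/negP => /adj_ore oq'; rewrite ore_sym in oq'.
have pc : perm_eq (A ++ [:: o] ++ X ++ [:: o'] ++ B) (C ++ X) by rewrite /C; perm_count.
apply: (too_long _ _ pc); first by rewrite (perm_uniq pc).
have qp : ore q p by rewrite ore_sym.
apply: pth_cycle qp; apply: pth_cat hA oq' _; apply: pth_cat (pth1 _ _) ox1 _.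
by apply: pth_cat hX yo' (pth_cat (pth1 _ _) op' hB).
Qed.

Lemma last_A : last p A = q'.
Proof. by case: A hA => //= z s /and3P[_ _ /eqP]. Qed.

Lemma count_arc (c2 : pred G) : (forall z, c2 z -> adj o' z) -> c2 q' ->
  count (adj o) A + count c2 A + size X <= (size A).+1.
Proof.
move=> c2o' c2q'; apply: (@count_gap _ _ _ _ A p) => //.
- apply/hasP; exists p; last exact: (th_bp T).
  by have [] := pth_mem hA.
- by rewrite last_A.
- by rewrite last_A exit_far.
move=> A1 w S w' A3 EA ow /c2o' o'w'; exact: gap_bound EA ow o'w'.
Qed.

End Path.
End Bypass.

Section Detour.
Variables (G : sgraph) (o o' p q' p' q x y : G) (A B P : seq G).
Hypothesis T : theta [:: o] o o o A p q' [:: o'] o' o' o' B p' q P x y.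
Hypotheses (pq : ore p q) (pq' : ore q' p').
Let C := o :: A ++ o' :: B.

Local Notation pth := (pth (@ore G)).

Section Far.
Variables (X : seq G) (x1 y1 : G).
Hypotheses (hX : pth x1 y1 X) (ox1 : ore o x1) (yo' : ore y1 o').
Hypothesis UCX : uniq (C ++ X).

Let UC : uniq C. Proof. by move: UCX; rewrite cat_uniq => /and3P[]. Qed.

Let arcs (c2 : pred G) : (forall z, c2 z -> adj o' z) ->
  (c2 q' -> count (adj o) A + count c2 A + size X <= (size A).+1) /\
  (c2 p' -> count (adj o) B + count c2 B + size X <= (size B).+1).
Proof.
move=> c2o'; split=> c2q; first exact: (count_arc T pq pq' hX ox1 yo' UCX c2o').
rewrite -(count_rev _ B) -(count_rev c2 B) -(size_rev B).
apply: (count_arc (theta_rev T) _ _ hX ox1 yo' _ c2o') => //; try by rewrite ore_sym.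
have pC : perm_eq ((o :: rev B ++ o' :: rev A) ++ X) (C ++ X) by rewrite /C; perm_count.
by rewrite (perm_uniq pC).
Qed.

Lemma light_ends : #|out C o| <= size X -> #|out C o'| <= size X -> ~~ adj o o' ->
  deg o + deg o' < #|G|.
Proof.
move=> so so' Noo'; have Noo := adj_irr o; have No'o' := adj_irr o'.
have [aA aB] : _ /\ _ := @arcs (adj o') (fun z => id).
have {}aA := aA (etrans (adj_sym _ _) (th_qa' T)); have {}aB := aB (th_bp' T).
rewrite (deg_count o UC) (deg_count o' UC) -(size_outside UC) /C.
have sX : size X <= #|[set w | w \notin C]|.
  rewrite -(@card_seq _ X); last by move: UCX; rewrite cat_uniq => /and3P[].
  apply/subset_leq_card/subsetP => w; rewrite !inE => wX.
  by move: UCX; rewrite cat_uniq => /and3P[_ /hasPn/(_ w wX)].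
move: sX so so'; rewrite -/C.
move: #|_| #|_| #|_| => m0 m1 m2.
rewrite /C /= !count_cat /= size_cat /= Noo No'o' [adj o' o]adj_sym (negbTE Noo').
have X0 : 0 < size X by case: (X) hX.
move: aA aB X0; move: (count _ A) (count _ B) (count _ A) (count _ B) (size A) (size B) (size X).
by clear; lia.
Qed.

Lemma light_outside (z : G) : z \notin C -> #|out C o| <= size X -> count (adj z) C <= 1 ->
  deg o + deg z < #|G|.
Proof.
move=> zC so cz; have Noo := adj_irr o.
have c2 (u : G) : pred1 q' u -> adj o' u by move/eqP=> ->; rewrite adj_sym (th_qa' T).
have [aA _] := arcs c2.
have {}aA := aA (eqxx q'); have [_ q'A] := pth_mem (th_A T).
have cq : 0 < count (pred1 q') A by rewrite -has_count has_pred1.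
rewrite (deg_count o UC) (deg_count z UC) -(size_outside UC).
have sz : #|out C z| < #|[set w | w \notin C]|.
  apply: proper_card; apply/properP; split.
    by apply/subsetP => w; rewrite !inE => /andP[].
  by exists z; rewrite !inE ?zC // adj_irr.
move: so cz sz; move: #|_| #|_| #|_| (count _ C) => m0 m1 m2 m3.
rewrite /C /= !count_cat /= size_cat /= Noo.
have := count_size (adj o) B; have := leq_b1 (adj o o').
move: aA cq; move: (count _ A) (count _ A) (count _ B) (size A) (size B) (size X) (adj o o' : nat).
by clear; lia.
Qed.

End Far.

Hypothesis claw : forall c u v w : G, adj c u -> adj c v -> adj c w ->
  u != v -> u != w -> v != w -> [|| ore u v, ore u w | ore v w].

Lemma out_size (X : seq G) v : {subset out C v <= X} -> #|out C v| <= size X.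
Proof.
move=> oX; rewrite cardE; apply: uniq_leq_size (enum_uniq _) _ => z.
by rewrite mem_enum => /oX.
Qed.

Lemma out_clique : {in out C o &, forall u v : G, u != v -> ore u v}.
Proof.
move=> u v; rewrite !in_set => /andP[ou uC] /andP[ov vC] uv.
have [pA _] := pth_mem (th_A T).
have pC w : w \notin C -> p != w.
  by apply: contraNneq => <-; rewrite inE mem_cat pA orbT.
have := claw (th_bp T) ou ov (pC _ uC) (pC _ vC) uv.
by rewrite (negbTE (outside_far T uC ou)) (negbTE (outside_far T vC ov)).
Qed.

Lemma clique_path (z : G) s : uniq (z :: s) -> {in z :: s &, forall u v : G, u != v -> ore u v} ->
  path ore z s.
Proof.
elim: s z => //= u s IH z /andP[zN Us] cl; rewrite cl ?mem_head //=; last 2 first.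
- by rewrite !inE eqxx orbT.
- by apply: contraNneq zN => ->; rewrite mem_head.
by apply: IH => // v w vs ws; apply: cl; rewrite inE ?vs ?ws orbT.
Qed.

(* Q, a path leaving o through x0, is prolonged backwards by all other outside
   neighbours of o, which form a clique. *)
Lemma detour x0 y0 Q : pth x0 y0 Q -> adj o x0 -> uniq (C ++ Q) ->
  (forall z, z \in Q -> adj o z -> z = x0) ->
  exists X x1, [/\ pth x1 y0 X, ore o x1, uniq (C ++ X), {subset out C o <= X}
    & {subset Q <= X}].
Proof.
move=> PQ ox0 UQ Qo; have [x0Q _] := pth_mem PQ.
have QC z : z \in Q -> z \notin C.
  by move=> zQ; move: UQ; rewrite cat_uniq => /and3P[_ /hasPn/(_ z zQ)].
have UQ' : uniq Q by move: UQ; rewrite cat_uniq => /and3P[].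
pose s := [seq z <- enum (out C o) | z != x0].
have sP z : z \in s -> [/\ z != x0, adj o z & z \notin C].
  by rewrite mem_filter mem_enum in_set => /and3P[].
have Us : uniq s by rewrite filter_uniq ?enum_uniq.
have sQ : uniq (s ++ Q).
  rewrite cat_uniq Us UQ' andbT; apply/hasPn => z zQ; apply/negP => /sP[zx /(Qo z zQ) E _].
  by rewrite E eqxx in zx.
exists (s ++ Q), (head x0 s); split.
- have x0o : x0 \in out C o by rewrite in_set ox0 QC.
  have so z : z \in s -> z \in out C o by move=> /sP[_ oz zC]; rewrite in_set oz.
  case Es: s => [|z t]; first exact: PQ.
  have Pz : path ore z t.
    apply: clique_path; first by rewrite -Es.
    by move=> u v us vs; apply: out_clique; apply: so; rewrite Es.
  apply: (pth_cat (y := last z t) _ _ PQ); first by rewrite /= !eqxx Pz.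
  have ls : last z t \in s by rewrite Es mem_last.
  by apply: out_clique => //; [exact: so | case: (sP _ ls)].
- case Es: s => [|z t] /=; first exact: adj_ore.
  by apply: adj_ore; case: (sP z) => //; rewrite Es mem_head.
- have UC : uniq C by move: UQ; rewrite cat_uniq => /and3P[].
  rewrite cat_uniq sQ UC andbT; apply/hasPn => z.
  by rewrite mem_cat => /orP[/sP[]|/QC].
- move=> z zo; rewrite mem_cat mem_filter mem_enum zo andbT; case: eqVneq => // ->; exact: x0Q.
by move=> z zQ; rewrite mem_cat zQ orbT.
Qed.

End Detour.

(** * Arcs that stop growing *)

Definition claw_ore (G : sgraph) := forall c u v w : G, adj c u -> adj c v ->
  adj c w -> u != v -> u != w -> v != w -> [|| ore u v, ore u w | ore v w].

Section Free.
Variable G : sgraph.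
Hypothesis claw : claw_ore G.
Implicit Types (U A V B P s : seq G) (a b o p q x y z u v : G).

Local Notation apth := (pth (@adj G)).
Local Notation pth := (pth (@ore G)).
Local Notation spanp := (spanp (@ore G)).
Local Notation link := (link (@ore G)).
Local Notation good := (good (@ore G)).

Lemma shrink U a o b A p q' V a' o' b' B p' q P x y :
  theta U a o b A p q' V a' o' b' B p' q P x y ->
  exists A1 p1 B1 q1, theta [:: o] o o o A1 p1 q' V a' o' b' B1 p' q1 P x y /\
    perm_eq ([:: o] ++ A1 ++ V ++ B1) (U ++ A ++ V ++ B).
Proof.
case=> tU tbp tA tqa' tV tbp' tB tqa tP tox tyo to to' Un Mx.
have [Ul [Ur EU]] : exists Ul Ur, U = Ul ++ o :: Ur.
  by case/splitPr: to => Ul Ur; exists Ul, Ur.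
have [PL PR] : apth a o (rcons Ul o) /\ apth o b (o :: Ur) by apply: pth_split; rewrite -EU.
have [p1 [op1 PA]] : exists p1, adj o p1 /\ apth p1 q' (Ur ++ A).
  case: (Ur) PR => [|r s] /and3P[_ /=].
    by move=> _ /eqP Eb; exists p; rewrite Eb.
  by move=> /andP[or Ps] Ls; exists r; split=> //; apply: (pth_cat (s := r :: s) (y :=
    b) _ tbp tA); rewrite /= eqxx Ps.
have [q1 [oq1 PB]] : exists q1, adj q1 o /\ apth p' q1 (B ++ Ul).
  case/lastP: (Ul) PL => [|s r] Ps.
    by exists q; rewrite cats0; case/and3P: Ps => /eqP <-.
  have Ps' : apth a o (s ++ r :: [:: o]) by move: Ps; rewrite -!cats1 -catA.
  have [Pr /and3P[_ /andP[ro _] _]] := pth_split Ps'.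
  by exists r; split=> //; apply: pth_cat tB tqa Pr.
have pS : perm_eq ([:: o] ++ (Ur ++ A) ++ V ++ B ++ Ul) (U ++ A ++ V ++ B).
  by rewrite EU; perm_count.
exists (Ur ++ A), p1, (B ++ Ul), q1; split=> //; split=> //; try exact: pth1.
- exact: mem_head.
- have pS' : perm_eq ([:: o] ++ (Ur ++ A) ++ V ++ (B ++ Ul) ++ P) (U ++ A ++ V ++ B ++ P).
    by rewrite EU; perm_count.
  by rewrite (perm_uniq pS').
by move=> c Uc Cc; rewrite (perm_size pS) Mx.
Qed.

Lemma start_ore o o' A B p q p' q' P x y :
  theta [:: o] o o o A p q' [:: o'] o' o' o' B p' q P x y -> ore p q.
Proof.
move=> T; have [pA _] := pth_mem (th_A T); have [_ qB] := pth_mem (th_B T).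
have [xP _] := pth_mem (th_P T).
have UC := th_uniq T.
have := claw (th_bp T) (etrans (adj_sym _ _) (th_qa T)) (th_ox T).
have disj u v s t : perm_eq (s ++ t) (A ++ B ++ P) -> u \in s -> v \in t -> u != v.
  move=> pst us vt; have : uniq (s ++ t).
    have pS : perm_eq ((s ++ t) ++ [:: o; o']) ([:: o] ++ A ++ [:: o'] ++ B ++ P) by perm_count.
    by move: UC; rewrite -(perm_uniq pS) cat_uniq => /andP[].
  rewrite cat_uniq => /and3P[_ /hasPn/(_ v vt) N _]; apply: contraNneq N => <-; exact: us.
have npq : p != q by apply: (disj p q A (B ++ P)); rewrite ?mem_cat ?qB.
have npx : p != x by apply: (disj p x A (B ++ P)); rewrite ?mem_cat ?xP ?orbT.
have nqx : q != x by apply: (disj q x B (A ++ P)); rewrite ?mem_cat ?xP ?orbT //; perm_count.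
move=> /(_ npq npx nqx).
have s1 : spanp [:: o] o o by exists [:: o]; rewrite pth1.
by rewrite (negbTE (ore_px T s1 xP)) (negbTE (ore_qx T s1 xP)) !orbF.
Qed.

Section FreeSide.
Variables (U A B P : seq G) (a o b p q' o' p' q x y : G).
Hypothesis T : theta U a o b A p q' [:: o'] o' o' o' B p' q P x y.
Hypotheses (gU : good U o a b) (cU : clean U) (dU : detached P U o).
Hypothesis fU : free U a b p q.

Let sa : spanp U o a. Proof. by case: gU. Qed.
Let sb : spanp U o b. Proof. by case: gU. Qed.
Let aU : a \in U. Proof. by have [] := pth_mem (th_U T). Qed.
Let bU : b \in U. Proof. by have [] := pth_mem (th_U T). Qed.
Let pU : p \notin U. Proof. by have [] := theta_p T. Qed.
Let qU : q \notin U. Proof. by have [] := theta_p T. Qed.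

Let outP z : z \in P -> [/\ z \notin U, z != p & z != q].
Proof.
move=> zP; have := th_uniq T; rewrite !catA cat_uniq => /and3P[_ /hasPn/(_ z zP) N _].
have [pA _] := pth_mem (th_A T); have [_ qB] := pth_mem (th_B T).
split.
- by apply: contra N => zU; rewrite !mem_cat zU.
- by apply: contraNneq N => ->; rewrite !mem_cat pA !orbT.
- by apply: contraNneq N => ->; rewrite !mem_cat qB !orbT.
Qed.

Let neq_pq : p != q.
Proof.
have [pA _] := pth_mem (th_A T); have [_ qB] := pth_mem (th_B T).
have := th_uniq T; rewrite !catA -catA cat_uniq => /and3P[_ /hasPn N _].
have := N q; rewrite mem_cat qB => /(_ isT); apply: contraNneq => <-.
by rewrite !mem_cat pA orbT.
Qed.

Lemma free_net : exists s : seq G, [/\ size s = 6, light_copy net_edges 0 s &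
  (exists2 t : seq G, size t = 6 & light_copy wounded_edges 0 t)
  \/ [/\ adj o a, adj o b & adj a b]].
Proof.
have [xP yP] := pth_mem (th_P T); have [xU xp xq] := outP xP.
have [fp fq fpq] := fU; have npq := neq_pq.
have bp := th_bp T; have qa := th_qa T; have ox := th_ox T.
have dx u : u \in U -> u != o -> ~~ ore x u by move=> uU uo; apply: dU.
have xnp : ~~ ore x p by rewrite ore_sym (ore_px T).
have xnq : ~~ ore x q by rewrite ore_sym (ore_qx T).
apply: (@light_net G U a b o x p q) => //;
  try by [rewrite adj_sym | exact: (th_o T) | exact: (th_U T)].
  have c1 : clean (p :: U).
    apply: clean_cons cU (adj_ore bp) bp _ => u uU ub pu.
    by have := fp u uU ub; rewrite pu.
  have c2 : clean (q :: p :: U).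
    apply: clean_cons c1 (_ : ore a q) _ _; rewrite ?[adj a q]adj_sym //.
      by rewrite adj_ore // adj_sym.
    move=> u; rewrite inE => /orP[/eqP->|uU] ua qu; first by rewrite ore_sym (negbTE fpq) in qu.
    by have := fq u uU ua; rewrite qu.
  have c3 : clean (x :: q :: p :: U).
    apply: clean_cons c2 (adj_ore ox) ox _ => u; rewrite !inE.
    case/or3P=> [/eqP->|/eqP->|uU] uo xu; first by rewrite xu in xnq.
      by rewrite xu in xnp.
    by have := dx u uU uo; rewrite xu.
  by move=> u v uK vK; apply: c3; rewrite !inE in uK vK *; rewrite [(_ == q) || _]orbCA.
case: sa => s [Ps ps]; case: s Ps ps => // z s /and3P[/eqP<- Ps /eqP Ls] ps.
have sU : all (mem U) (o :: s) by apply/allP => u; rewrite (perm_mem ps).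
exists s; last by case/andP: sU.
by apply: sub_in_path sU Ps => u v uU vU; apply: cU.
Qed.

Hypothesis Px : forall z, z \in P -> adj o z -> z = x.
Hypothesis P_far : 1 < size P -> forall z, z \notin U ++ A ++ [:: o'] ++ B ->
  count (adj z) (U ++ A ++ [:: o'] ++ B) <= 1.

Lemma free_wounded : adj o a -> adj o b -> adj a b ->
  exists2 t : seq G, size t = 6 & light_copy wounded_edges 0 t.
Proof.
move=> oa ob ab; have [[noa nob] nab] := (adj_neq oa, adj_neq ob, adj_neq ab).
have oU := th_o T; have UU : uniq U by have := th_uniq T; rewrite cat_uniq => /andP[].
have [fp fq fpq] := fU.
have nba : b != a by rewrite eq_sym.
have clash u v w z t : link U u v w z -> t \in [:: u; v] -> t \in [:: w; z] -> False.
  by move=> L t1 t2; have := link_disjoint UU L t1 t2; rewrite eqxx.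
have [_ _ Hb Ha] := gU.
have Lb : link U o a b b.
  by case: (Ha b bU nba) => // L; case: (clash _ _ _ _ b L); rewrite !inE eqxx ?orbT.
have La : link U o b a a.
  by case: (Hb a aU nab) => // L; case: (clash _ _ _ _ a L); rewrite !inE eqxx ?orbT.
have L0 : link U o o a b.
  by case: (Hb o oU nob) => // L; case: (clash _ _ _ _ o L); rewrite !inE eqxx ?orbT.
have [A1 [p1 [B1 [q1 [T0 pS0]]]]] := shrink T.
have p1q1 := start_ore T0; have p'q' := start_ore (theta_swap T0).
have q'p' : ore q' p' by rewrite ore_sym.
have so' : spanp [:: o'] o' o' by exists [:: o']; rewrite pth1.
have [A2 [p2 [B2 [q2 [_ _ TS]]]]] := absorb_pq (theta_swap T) so' so' sa sb p'q'.
have T1 := theta_swap TS; rewrite revK in T1.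
have [xP yP] := pth_mem (th_P T).
have [qo' op'] := (adj_ore (th_qa' T), adj_ore (th_bp' T)).
have Lm' : link (q' :: rcons [:: o'] p') o' q' p' p'.
  exists [:: o'; q'], [:: p']; split; rewrite ?pth1 //; last by perm_count.
  by rewrite /= !eqxx ore_sym qo'.
have L0' : link (q' :: rcons [:: o'] p') o' o' q' p'.
  exists [:: o'], [:: q'; p']; split; rewrite ?pth1 //; last by perm_count.
  by rewrite /= !eqxx q'p'.
have Npp' := ore_pm T1 sa Lm'; have Npo' := ore_p0 T1 sa L0'.
have Nbp' := ore_mm T1 Lb Lm'; have Nop' := ore_0m T1 L0 Lm'.
have No'b := ore_0m TS L0' Lb; have No'a := ore_0p TS L0' La.
have Npx z : z \in P -> ~~ ore p z by apply: (ore_px T sa).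
have Np'x : ~~ ore p' x by apply: (ore_px (theta_swap T) so'); rewrite mem_rev.
have dis u v : u \in U -> v \in q' :: rcons [:: o'] p' -> u != v by apply: (theta_disj T1).
have o'V : o' \in q' :: rcons [:: o'] p' by rewrite !inE eqxx orbT.
have p'V : p' \in q' :: rcons [:: o'] p' by rewrite !inE eqxx !orbT.
have [xnU xp xq] := outP xP.
have ap u v : u != v -> ~~ ore u v -> apart u v by rewrite /apart => -> ->.
have op_ : apart o p by rewrite apart_sym; apply: ap; [apply: contraNneq pU => -> | apply: fp].
have ap_ : apart a p by rewrite apart_sym; apply: ap; [apply: contraNneq pU => -> | apply: fp].
have Ux z u : z \in P -> u \in U -> u != o -> apart u z.
  move=> zP uU uo; rewrite apart_sym; apply: ap; last exact: dU.
  by apply: contraTneq zP => ->; apply/negP => /outP[]; rewrite uU.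
have bo : b != o by rewrite eq_sym. have ao : a != o by rewrite eq_sym.
have zp z : z \in P -> apart p z.
  by move=> zP; apply: ap; [case: (outP zP); rewrite eq_sym | apply: Npx].
have bp := th_bp T; have ox := th_ox T.
have via z : adj x z -> apart o z -> apart b z -> apart a z -> apart p z ->
    exists2 t : seq G, size t = 6 & light_copy wounded_edges 0 t.
  move=> xz oz bz az pz; exists [:: b; o; a; p; x; z] => //.
  apply: wounded_copy => //; rewrite ?[adj b _]adj_sym //; try exact: Ux; exact: zp.
have UC0 : uniq ((o :: A1 ++ o' :: B1) ++ P).
  by have := th_uniq T0; rewrite /= -!catA.
have yo' := adj_ore (th_yo T).
have [t EP] : exists t, P = x :: t.
  by have := th_P T; case: (P) => // z t /and3P[/eqP<-]; exists t.
case: t EP => [|x2 t] EP; last first.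
  have x2P : x2 \in P by rewrite EP !inE eqxx orbT.
  have xx2 : adj x x2 by have := th_P T; rewrite EP => /and3P[_ /andP[]].
  apply: (via x2) => //; try exact: Ux; last exact: zp.
  have ox2 : o != x2.
    by apply: contraTneq oU => ->; case: (outP x2P).
  have Nox2 : ~~ adj o x2.
    apply/negP => /(Px x2P) E; move: UC0.
    by rewrite cat_uniq => /and3P[_ _]; rewrite EP /= E mem_head.
  apply: ap => //; rewrite /ore ox2 (negbTE Nox2) /= -ltnNge.
  have [X [x1 [PX ox1 UX outX _]]] := detour T0 claw (pth_adj (th_P T)) ox UC0 Px.
  apply: (light_outside T0 p1q1 q'p' PX ox1 yo' UX).
  - by move: UC0; rewrite cat_uniq => /and3P[_ /hasPn/(_ x2 x2P)].
  - exact: out_size.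
  have pC : perm_eq (o :: A1 ++ o' :: B1) (U ++ A ++ [:: o'] ++ B) by [].
  rewrite (permP pC); apply: P_far; first by rewrite EP.
  rewrite -(perm_mem pC).
  by move: UC0; rewrite cat_uniq => /and3P[_ /hasPn/(_ x2 x2P)].
have Ey : y = x by have := th_P T; rewrite EP => /and3P[_ _ /eqP].
have xo' : adj x o' by rewrite -Ey (th_yo T).
have oo'n : o != o' by apply: dis.
have o'b_ : apart o' b by apply: ap; rewrite // eq_sym; apply: dis.
have o'a_ : apart o' a by apply: ap; rewrite // eq_sym; apply: dis.
have pV v : v \in q' :: rcons [:: o'] p' -> p != v.
  move=> vV; have [pB2 _] := pth_mem (th_A T1).
  have := th_uniq T1; rewrite catA cat_uniq => /and3P[].
  rewrite cat_uniq => /and3P[_ _ _] /hasPn N _.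
  have := N v; rewrite mem_cat vV => /(_ isT); apply: contraNneq => <-.
  by rewrite mem_cat pB2 orbT.
have po'_ : apart p o' by apply: ap => //; apply: pV.
have [aoo'|naoo'] := boolP (adj o o').
  exists [:: o'; o; x; p'; b; p] => //; apply: wounded_copy => //; try exact: Ux.
  - by rewrite adj_sym.
  - by rewrite adj_sym.
  - exact: (th_bp' T).
  - by rewrite apart_sym.
  - by apply: ap => //; apply: dis.
  - rewrite apart_sym; apply: ap => //; apply: contraTneq xP => <-.
    have [p'B _] := pth_mem (th_B T).
    have := th_uniq T; rewrite !catA cat_uniq => /and3P[_ /hasPn N _].
    by apply/negP => /N; rewrite !mem_cat p'B !orbT.
  - by rewrite apart_sym; apply: Ux.
  - by rewrite apart_sym; apply: zp.
  - by rewrite apart_sym; apply: ap => //; apply: dis.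
  by rewrite apart_sym; apply: ap => //; apply: pV.
apply: (via o') => //; last first.
- by rewrite apart_sym.
- by rewrite apart_sym.
apply: ap => //; rewrite /ore oo'n (negbTE naoo') /= -ltnNge.
pose C0 := o :: A1 ++ o' :: B1; pose s := [seq z <- enum (out C0 o') | (z != x) && ~~ adj o z].
have pC : perm_eq C0 (o' :: B1 ++ o :: A1) by rewrite /C0; perm_count.
have sP z : z \in s -> [/\ z != x, ~~ adj o z, adj o' z & z \notin C0].
  by rewrite mem_filter mem_enum in_set => /andP[/andP[-> ->] /andP[-> ->]].
have xC : x \notin C0.
  by move: UC0; rewrite cat_uniq => /and3P[_ /hasPn/(_ x xP)].
have Us : uniq (x :: s).
  by rewrite /= filter_uniq ?enum_uniq // andbT; apply/negP => /sP[]; rewrite eqxx.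
have so z : z \in x :: s -> adj o' z /\ z \notin C0.
  by rewrite inE => /orP[/eqP->|/sP[]//]; rewrite adj_sym.
have PQ : pth x (last x s) (x :: s).
  rewrite /= !eqxx andbT /=; apply: clique_path Us _ => u v /so[ou uC] /so[ov vC].
  by apply: (out_clique (theta_swap T0) claw); rewrite in_set ?ou ?ov -(perm_mem pC) ?uC ?vC.
have lo' : ore (last x s) o'.
  by rewrite ore_sym; apply: adj_ore; case: (so _ (mem_last x s)).
have UQ : uniq (C0 ++ x :: s).
  rewrite cat_uniq Us andbT; apply/andP; split.
    by move: UC0; rewrite cat_uniq => /andP[].
  by apply/hasPn => z /so[].
have Qo z : z \in x :: s -> adj o z -> z = x.
  by rewrite inE => /orP[/eqP->//|/sP[_ /negbTE->]].
have [X [x1 [PX ox1 UX outX QX]]] := detour T0 claw PQ ox UQ Qo.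
apply: (light_ends T0 p1q1 q'p' PX ox1 lo' UX) => //; first exact: out_size.
apply: out_size => z zo; have [zx|zx] := eqVneq z x; first by apply: QX; rewrite zx mem_head.
have [oz|oz] := boolP (adj o z); last first.
  by apply: QX; rewrite inE mem_filter mem_enum zo oz zx orbT.
by apply: outX; move: zo; rewrite !in_set oz => /andP[_ ->].
Qed.

End FreeSide.
End Free.

(** * Longest cycles and shortest outside paths *)

Lemma claw_oreP (G : sgraph) : heavy K13 G -> claw_ore G.
Proof.
move=> hK c u v w cu cv cw uv uw vw; apply/negPn/negP; rewrite !negb_or => /and3P[Nuv Nuw Nvw].
apply: (no_light_copy (s := [:: c; u; v; w]) hK) => //.
by rewrite /light_copy /fits_row /fits /apart /= cu cv cw uv uw vw Nuv Nuw Nvw.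
Qed.

Section Start.
Variable G : sgraph.
Hypothesis G2 : k_connected 2 G.
Implicit Types (u v w x y z : G) (c s t C : seq G).

Local Notation adj := (@adj G).

Lemma avoiding_path w u v : u != w -> v != w ->
  exists s, [/\ path adj u s, last u s = v & w \notin s].
Proof.
move=> uw vw; have [_ /(_ [set w])] := G2; rewrite cards1 => /(_ isT)[_ con].
have inC z : z != w -> z \in ~: [set w] by rewrite !inE.
have /connectP[s Ps Es] := con (exist _ u (inC u uw)) (exist _ v (inC v vw)).
exists (map val s); split.
- by rewrite -[u]/(val (exist (fun z => z \in ~: [set w]) u (inC u uw))) path_map.
- by rewrite -[u]/(val (exist (fun z => z \in ~: [set w]) u (inC u uw))) last_map -Es.
by apply/mapP => -[[z zw] _ /= E]; move: zw; rewrite !inE E eqxx.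
Qed.

Lemma first_step w u v : u != w -> v != w -> u != v -> exists x, [/\ adj u x, x != w & x != u].
Proof.
move=> uw vw uv; have [[|x s] [/= Ps Ls ws]] := avoiding_path uw vw.
  by rewrite Ls eqxx in uv.
case/andP: Ps => ux _; exists x; split=> //; last by rewrite eq_sym adj_neq.
by apply: contraNneq ws => ->; rewrite mem_head.
Qed.

Lemma cycle_exists : exists c, [/\ uniq c, cycle adj c & 2 < size c].
Proof.
have [/card_gt2P[u [v [w [_ [uv vw wu]]]]] _] := G2.
have uw : u != w by rewrite eq_sym.
have [x [ux xw xu]] := first_step uw vw uv.
have [y [uy yx yu]] : exists y, [/\ adj u y, y != x & y != u].
  by apply: (first_step (v := w)); rewrite // eq_sym.
have [s [Ps Ls us]] := avoiding_path xu yu.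
case/shortenP: Ps Ls => s' Ps' Us' ss' Ls.
exists (u :: x :: s'); split.
- rewrite cons_uniq Us' andbT inE eq_sym negb_or xu /=.
  by apply: contra us; apply: ss'.
- by rewrite /= ux rcons_path Ps' Ls adj_sym.
case: s' Ls {Ps' Us' ss'} => //= E; by rewrite E eqxx in yx.
Qed.

Lemma longest_cycle : exists C, [/\ uniq C, cycle adj C, 2 < size C
  & forall c, uniq c -> cycle ore c -> size c <= size C].
Proof.
pose has_cycle k := [exists t : k.-tuple G, [&& uniq t, cycle adj t & 2 < k]].
have inh c : uniq c -> cycle adj c -> 2 < size c -> has_cycle (size c).
  by move=> Uc Cc sc; apply/existsP; exists (in_tuple c); apply/and3P.
have ex : exists k, has_cycle k.
  by have [c [Uc Cc sc]] := cycle_exists; exists (size c); apply: inh.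
have bnd k : has_cycle k -> k <= #|G|.
  case/existsP=> t /and3P[Ut _ _]; rewrite -(size_tuple t) -(card_uniqP Ut).
  exact: max_card.
case: (ex_maxnP ex bnd) => k /existsP[t /and3P[Ut Ct st]] kmax.
exists t; split; rewrite ?size_tuple // => c Uc Cc.
have [sc|sc] := leqP (size c) 2; first by apply: leq_trans sc (ltnW st).
have [c' [Uc' Cc' sc']] := ore_cycle Uc sc Cc.
by apply: leq_trans (kmax _ (inh c' Uc' Cc' _)); rewrite // (leq_trans sc).
Qed.

Section Ear.
Variables (C : seq G) (z0 : G).
Hypotheses (UC : uniq C) (sC : 2 < size C) (z0C : z0 \notin C).

Let outside := [pred z | z \notin C].

Lemma exit_path w : w \in C -> exists u s, [/\ u \in C, u != w, path adj z0 (rcons s u)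
  & all outside (z0 :: s)].
Proof.
move=> wC; have [v vC vw] : exists2 v, v \in C & v != w.
  case: C UC sC => [|v1 [|v2 c]] //= /andP[]; rewrite inE negb_or => /andP[v12 _] _ _.
  have [E|N] := eqVneq v1 w; last by exists v1; rewrite ?mem_head.
  by exists v2; rewrite ?inE ?eqxx ?orbT // -E eq_sym.
have z0w : z0 != w by apply: contraNneq z0C => ->.
have [s [Ps Ls ws]] := avoiding_path z0w vw.
have hs : has (mem C) s.
  apply/hasP; exists v => //; rewrite -Ls; move: vC; rewrite -Ls.
  by case: (s) => [|r s'] /=; [rewrite (negbTE z0C) | rewrite mem_last].
have [s1 [u [s2 [Es uC Ns1]]]] := first_occurrence hs.
exists u, s1; split=> //.
- by apply: contraNneq ws => <-; rewrite Es mem_cat mem_head orbT.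
- by move: Ps; rewrite Es -cat_rcons cat_path => /andP[].
apply/andP; split=> //; apply/allP => z zs1; apply: contra Ns1 => zC.
by apply/hasP; exists z.
Qed.

Definition ear u v x t := [&& u \in C, v \in C, u != v, adj u x, adj (last x t) v,
  path adj x t, all outside (x :: t) & uniq (x :: t)].

Lemma ear_exists : exists u v x t, ear u v x t.
Proof.
have [w wC] : exists w, w \in C by case: C sC => // w c _; exists w; rewrite mem_head.
have [u [s [uC _ Ps os]]] := exit_path wC; have [v [t [vC vu Pt ot]]] := exit_path uC.
pose e' := [rel x y | [&& adj x y, outside x & outside y]].
have e'P r : path adj z0 r -> all outside (z0 :: r) -> connect e' z0 (last z0 r).
  move=> Pr or; apply/connectP; exists r => //.
  by apply: sub_in_path or Pr => x y; rewrite !inE /= => xo yo ->; rewrite xo yo.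
have e'sym : connect_sym e'.
  apply: sym_connect_sym => x y /=; rewrite adj_sym.
  by case: (x \in C); case: (y \in C); rewrite ?andbF.
move: Ps Pt; rewrite !rcons_path => /andP[Ps su] /andP[Pt tv].
have /connectP[r Pr Er] : connect e' (last z0 s) (last z0 t).
  by rewrite (connect_trans (y := z0)) ?e'P // e'sym e'P.
case/shortenP: Pr Er => r' Pr' Ur' _ Er.
have lo : outside (last z0 s) by apply: (allP os); rewrite mem_last.
exists u, v, (last z0 s), r'; apply/and5P; split=> //; first by rewrite eq_sym.
  by rewrite adj_sym.
rewrite Ur' -Er tv andbT /=; apply/andP; split.
  by apply: sub_path Pr' => x y /and3P[].
apply/andP; split; first exact: lo.
by elim: r' (last z0 s) Pr' {Ur' Er su lo} => //= y r' IH x /andP[/and3P[_ _ ->] /IH].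
Qed.

Lemma minimal_ear : exists u v x t, [/\ ear u v x t,
  forall z, z \in x :: t -> adj u z -> z = x,
  forall z, z \in x :: t -> adj v z -> z = last x t
  & 1 < size (x :: t) -> forall z, z \notin C -> count (adj z) C <= 1].
Proof.
pose has_ear k := [exists u, exists v, exists x, exists t : k.-tuple G, ear u v x t].
have inh u v x t : ear u v x t -> has_ear (size t).
  move=> E; apply/existsP; exists u; apply/existsP; exists v; apply/existsP; exists x.
  by apply/existsP; exists (in_tuple t).
have ex : exists k, has_ear k.
  by have [u [v [x [t E]]]] := ear_exists; exists (size t); apply: inh E.
case: (ex_minnP ex) => k /existsP[u /existsP[v /existsP[x /existsP[t E]]]] kmin.
exists u, v, x, t; split=> //; last 1 first.
- rewrite /= size_tuple ltnS => k0 z zC; rewrite leqNgt; apply/negP => c2.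
  have : 1 < size (filter (adj z) C) by rewrite size_filter.
  case Ef: (filter _ C) => [|c1 [|d1 r]] // _.
  have /andP[zc1 c1C] : adj z c1 && (c1 \in C) by rewrite -mem_filter Ef mem_head.
  have /andP[zd1 d1C] : adj z d1 && (d1 \in C) by rewrite -mem_filter Ef !inE eqxx orbT.
  have cd : c1 != d1.
    by have := filter_uniq (adj z) UC; rewrite Ef /= inE negb_or => /andP[/andP[]].
  have /kmin : has_ear 0.
    apply: (inh c1 d1 z [::]); apply/and5P; split=> //; first by rewrite adj_sym.
    by rewrite /= zd1 zC.
  by rewrite leqNgt k0.
- move=> z; rewrite inE => /orP[/eqP//|zt uz].
  have [t1 [t2 Et]] : exists t1 t2, tval t = t1 ++ z :: t2.
    by case/splitPr: zt => t1 t2; exists t1, t2.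
  case/and5P: E => uC vC uv ux /and4P[tv Pt ot Ut].
  have /kmin : has_ear (size t2).
    apply: (inh u v z t2); rewrite Et in tv Pt ot Ut; apply/and5P; split=> //.
    move: tv Pt ot Ut; rewrite last_cat /= => -> /=.
    rewrite cat_path all_cat /= => /and3P[_ _ ->] /and3P[_ _ /andP[-> ->]] /=.
    by case/andP=> _; rewrite cat_uniq => /and3P[_ _ /= ->].
  by rewrite -(size_tuple t) Et size_cat /= addnS leqNgt ltnS leq_addl.
move=> z zt vz.
have [t1 [t2 Et]] : exists t1 t2, x :: tval t = t1 ++ z :: t2.
  by case/splitPr: zt => t1 t2; exists t1, t2.
case: t2 Et => [|z2 t2] Et.
  by have := congr1 (last x) Et; rewrite last_cat /=.
case/and5P: E => uC vC uv ux /and4P[tv Pt ot Ut].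
have [r Er] : exists r, rcons t1 z = x :: r.
  by case: (t1) Et => [|y1 t1'] [-> _]; [exists [::] | exists (rcons t1' z)].
have Et' : tval t = r ++ z2 :: t2.
  have : x :: tval t = (x :: r) ++ z2 :: t2 by rewrite -Er cat_rcons.
  by case.
have Lr : last x r = z by have := congr1 (last x) Er; rewrite last_rcons.
have /kmin : has_ear (size r).
  apply: (inh u v x r); rewrite Et' in Pt ot Ut; apply/and5P; split=> //.
  rewrite Lr adj_sym vz /=; move: Pt ot Ut; rewrite cat_path /= all_cat /= mem_cat negb_or cat_uniq.
  by case/andP=> -> _ /and3P[-> -> _] /andP[/andP[-> _] /andP[-> _]].
by move=> kr; exfalso; move: kr; rewrite -(size_tuple t) Et' size_cat /= addnS leqNgt ltnS leq_addr.
Qed.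

End Ear.
End Start.

Section Sufficiency.
Variable G : sgraph.
Hypotheses (G2 : k_connected 2 G) (claw : claw_ore G).

Lemma initial_theta (C : seq G) (z0 : G) : uniq C -> cycle (@adj G) C -> 2 < size C ->
  (forall c : seq G, uniq c -> cycle ore c -> size c <= size C) -> z0 \notin C ->
  exists (o o' : G) (A B P : seq G) (p q p' q' x y : G),
  [/\ theta [:: o] o o o A p q' [:: o'] o' o' o' B p' q P x y,
      forall z, z \in P -> adj o z -> z = x,
      forall z, z \in P -> adj o' z -> z = y
    & 1 < size P -> forall z, z \notin [:: o] ++ A ++ [:: o'] ++ B ->
      count (adj z) ([:: o] ++ A ++ [:: o'] ++ B) <= 1].
Proof.
move=> UC CC sC maxC z0C.
have [u [v [x [t [E Eu Ev Efar]]]]] := minimal_ear G2 UC sC z0C.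
case/and5P: E => uC vC uv ux /and4P[tv Pt ot Ut].
have [i C' EC'] := rot_to uC.
have vC' : v \in C'.
  have : v \in rot i C by rewrite mem_rot.
  by rewrite EC' inE eq_sym (negbTE uv).
have [A [B EAB]] : exists A B, C' = A ++ v :: B.
  by case/splitPr: vC' => A B; exists A, B.
rewrite {}EAB in EC'.
have pC : perm_eq ([:: u] ++ A ++ [:: v] ++ B) C.
  by rewrite perm_sym -(perm_rot i) EC'.
have UCt : uniq ((x :: t) ++ [:: u] ++ A ++ [:: v] ++ B).
  rewrite cat_uniq Ut (perm_uniq pC) UC andbT; apply/hasPn => z zC.
  by apply: contraL (zC) => /(allP ot); rewrite (perm_mem pC).
have maxP (c : seq G) : perm_eq c ((x :: t) ++ [:: u] ++ A ++ [:: v] ++ B) -> cycle ore c -> False.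
  move=> pc Cc; have := maxC c; rewrite (perm_uniq pc) (perm_size pc) size_cat (perm_size pC).
  by move=> /(_ UCt Cc); rewrite -[X in _ <= X]add0n leq_add2r.
have := CC; rewrite -(rot_cycle i) EC' /= rcons_cat cat_path /= => /and3P[PA Av PB].
have hxt : pth (@ore G) x (last x t) (x :: t).
  by rewrite /= !eqxx andbT /=; apply: sub_path Pt => *; apply: adj_ore.
have [h_ux h_tv] : ore u x /\ ore (last x t) v by rewrite !adj_ore // adj_sym.
have osym := @ore_sym G.
have A0 : A != [::].
  apply/eqP => A0; rewrite A0 in PA Av maxP.
  have PBo : path ore v (rcons B u) by apply: sub_path PB => *; apply: adj_ore.
  case: (@maxP ([:: u] ++ (x :: t) ++ v :: B)); first by perm_count.
  move: PBo; rewrite rcons_path => /andP[PBo Bu].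
  apply: (pth_cycle (x := u) (y := last v B)) Bu.
  apply: pth_cat (pth1 _ _) h_ux _; apply: pth_cat hxt h_tv _.
  by rewrite /= !eqxx PBo.
have B0 : B != [::].
  apply/eqP => B0; rewrite B0 in PB maxP.
  have PAo : path ore u (rcons A v).
    by rewrite rcons_path; apply/andP; split; [apply: sub_path PA => *;
      apply: adj_ore | apply: adj_ore].
  case: (@maxP (([:: u] ++ A ++ [:: v]) ++ rev (x :: t))); first by perm_count.
  have xu : ore x u by rewrite ore_sym.
  have vt : ore v (last x t) by rewrite ore_sym.
  apply: pth_cycle xu; apply: (pth_cat (y := v) _ vt (pth_rev osym hxt)).
  by rewrite /= eqxx cats1 PAo last_rcons eqxx.
case: A A0 PA Av EC' pC UCt {maxP} => // p A _ PA Av EC' pC UCt.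
case: B B0 PB EC' pC UCt => // p' B _ PB EC' pC UCt.
exists u, v, (p :: A), (p' :: B), (x :: t), p, (last p' B), p', (last p A), x, (last x t).
move: PA PB; rewrite /= rcons_path => /andP[up PA] /and3P[vp' PB Bu].
split=> //; last first.
  by move=> /Efar far z; have := far z; rewrite -(perm_mem pC) -(permP pC).
split; rewrite /= ?eqxx ?andbT ?mem_head //; try by rewrite adj_sym.
  have pU : perm_eq ([:: u] ++ (p :: A) ++ [:: v] ++ (p' :: B) ++ x :: t)
                    ((x :: t) ++ [:: u] ++ (p :: A) ++ [:: v] ++ p' :: B) by perm_count.
  by move: UCt; rewrite -(perm_uniq pU).
move=> c Uc Cc; rewrite -[X in _ <= X]/(size ([:: u] ++ (p :: A) ++ [:: v] ++ p' :: B)).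
by rewrite (perm_size pC) maxC.
Qed.

Definition net_and_wounded :=
  (exists2 s : seq G, size s = 6 & light_copy net_edges 0 s) /\
  (exists2 s : seq G, size s = 6 & light_copy wounded_edges 0 s).

Lemma free_copies (U A B P : seq G) (a o b p q' o' p' q x y : G) :
  theta U a o b A p q' [:: o'] o' o' o' B p' q P x y ->
  good ore U o a b -> clean U -> detached P U o -> free U a b p q ->
  (forall z, z \in P -> adj o z -> z = x) ->
  (1 < size P -> forall z, z \notin U ++ A ++ [:: o'] ++ B ->
     count (adj z) (U ++ A ++ [:: o'] ++ B) <= 1) ->
  net_and_wounded.
Proof.
move=> T gU cU dU fU Px far; have [s [ss net_s H]] := free_net claw T gU cU dU fU.
split; first by exists s.
by case: H => // -[oa ob ab]; apply: (free_wounded claw T gU dU fU Px far).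
Qed.

Lemma hamiltonian_or_copies : hamiltonian G \/ net_and_wounded.
Proof.
have [C [UC CC sC maxC]] := longest_cycle G2.
have [/forallP allC|/forallPn[z0 z0C]] := boolP [forall z, z \in C].
  by left; exists C.
right; have [o [o' [A [B [P [p [q [p' [q' [x [y [T Px Py far]]]]]]]]]]]] :=
  initial_theta UC CC sC maxC z0C.
have clean1 (z : G) : clean [:: z].
  by move=> u v; rewrite !inE => /eqP-> /eqP->; rewrite ore_irr.
have det1 (Q : seq G) (z : G) : detached Q [:: z] z.
  by move=> u v _; rewrite inE => /eqP->; rewrite eqxx.
have [U [a [b [A1 [p1 [B1 [q1 [T1 gU pU1 H1]]]]]]]] :=
  growth T (good1 _ o) (good1 _ o') (clean1 o) (det1 P o).
case: H1 => [[cU dU fU]|cfU].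
  apply: (free_copies T1 gU cU dU fU Px) => sP z.
  by rewrite (perm_mem pU1) (permP pU1); apply: far.
have S1 := theta_swap T1.
have [V [a' [b' [B2 [p2 [A2 [q2 [T2 gV pV H2]]]]]]]] :=
  growth S1 (good1 _ o') gU (clean1 o') (det1 (rev P) o').
case: H2 => [[cV dV fV]|cfV]; last by case: (no_two_conflicts T2 cfV cfU).
have [A3 [p3 [B3 [q3 [T3 pT3]]]]] := shrink (theta_swap T2).
have T4 := theta_swap T3; rewrite revK in T4.
apply: (free_copies T4 gV cV dV fV).
  by move=> z; rewrite mem_rev => zP; apply: Py.
rewrite size_rev => sP z;
  have pall : perm_eq (V ++ B3 ++ [:: o] ++ A3) ([:: o] ++ A ++ [:: o'] ++ B).
  have e1 : perm_eq (V ++ B3 ++ [:: o] ++ A3) ([:: o] ++ A3 ++ V ++ B3) by perm_count.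
  apply: perm_trans e1 (perm_trans pT3 _); apply: perm_trans pU1.
  have e2 : perm_eq (U ++ A2 ++ V ++ B2) (V ++ B2 ++ U ++ A2) by perm_count.
  apply: perm_trans e2 (perm_trans pV _).
  by perm_count.
by rewrite (perm_mem pall) (permP pall); apply: far.
Qed.

End Sufficiency.

Theorem light_copies_of_nonhamiltonian (G : sgraph) : k_connected 2 G ->
  heavy K13 G -> hamiltonian G \/ net_and_wounded G.
Proof. by move=> G2 /claw_oreP; apply: hamiltonian_or_copies. Qed.

(** * Searching small graphs *)

Lemma isomorphic_sym (G H : sgraph) : isomorphic G H -> isomorphic H G.
Proof.
case=> f [[g fK gK] fadj]; exists g; split; first by exists f.
by move=> x y; rewrite -fadj !gK.
Qed.

Lemma isomorphic_trans (G H K : sgraph) :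
  isomorphic G H -> isomorphic H K -> isomorphic G K.
Proof.
case=> f [bf fadj] [g [bg gadj]]; exists (g \o f); split; first exact: bij_comp.
by move=> x y; rewrite /= gadj fadj.
Qed.

Lemma heavy_iso (G H K : sgraph) : isomorphic H K -> heavy H G -> heavy K G.
Proof.
move=> HK hH A /isomorphic_trans AK; apply: hH; apply: AK.
exact: isomorphic_sym.
Qed.

Definition eadj (E : seq (nat * nat)) : rel nat := fun i j => (i != j) && edge_in E i j.

Lemma eadj_sym E : symmetric (eadj E).
Proof. by move=> i j; rewrite /eadj eq_sym /edge_in orbC. Qed.

Lemma eadj_irr E : irreflexive (eadj E).
Proof. by move=> i; rewrite /eadj eqxx. Qed.

Section Search.
Variables (g a : rel nat) (cand : seq nat) (fin : pred (seq nat)).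

Definition extends acc v :=
  (v \notin acc) && all (fun j => a (nth 0 acc j) v == g j (size acc)) (iota 0 (size acc)).

Fixpoint search k acc :=
  if k is k'.+1
  then has (fun v => if extends acc v then search k' (rcons acc v) else false) cand
  else fin acc.

Definition partial_copy t := [/\ uniq t, {subset t <= cand}
  & forall i j, i < j < size t -> a (nth 0 t i) (nth 0 t j) = g i j].

Lemma partial_copy_rcons acc v : v \in cand ->
  partial_copy (rcons acc v) <-> partial_copy acc /\ extends acc v.
Proof.
move=> vc; split.
- case; rewrite rcons_uniq => /andP[vN Ua] sub adjP; split.
    split=> //; first by move=> u ua; apply: sub; rewrite mem_rcons inE ua orbT.
    move=> i j /andP[ij ja]; have := adjP i j.
    rewrite size_rcons ij !nth_rcons ja (ltn_trans ij ja) => -> //.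
    by rewrite ltnS ltnW.
  rewrite /extends vN; apply/allP => j; rewrite mem_iota /= add0n => ja.
  by have := adjP j (size acc); rewrite size_rcons ja !nth_rcons ja ltnn eqxx ltnSn => ->.
case=> [[Ua sub adjP] /andP[vN /allP ext]]; split; first by rewrite rcons_uniq vN.
  by move=> u; rewrite mem_rcons inE => /orP[/eqP->//|/sub].
move=> i j /andP[ij]; rewrite size_rcons ltnS leq_eqVlt => /orP[/eqP ja|ja].
  by rewrite !nth_rcons -ja ij ltnn eqxx ja; apply/eqP/ext; rewrite mem_iota add0n -ja.
by rewrite !nth_rcons ja (ltn_trans ij ja) adjP ?ij.
Qed.

Lemma partial_copy_take t k : partial_copy t -> partial_copy (take k t).
Proof.
case=> Ut sub adjP; split; first exact: take_uniq.
  by move=> u /mem_take/sub.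
move=> i j /andP[ij jk]; have jk' : j < k by apply: leq_trans jk _; rewrite size_take; case: ltnP.
rewrite !nth_take ?(ltn_trans ij) // adjP // ij /=.
by apply: leq_trans jk _; rewrite size_take; case: ltnP => // /ltnW.
Qed.

Lemma searchP k acc : partial_copy acc ->
  search k acc <-> exists t, [/\ size t = size acc + k, take (size acc) t = acc,
                              partial_copy t & fin t].
Proof.
elim: k acc => [|k IH] acc pacc /=.
  split=> [facc|[t [st Et _ ft]]].
    by exists acc; rewrite addn0 take_size.
  by rewrite -Et take_oversize ?st ?addn0.
split.
  case/hasP=> v vc /andP[ev sv].
  have pv : partial_copy (rcons acc v) by apply/partial_copy_rcons.
  have [t [st Et pt ft]] := (IH _ pv).1 sv.
  exists t; split=> //; first by rewrite st size_rcons addSnnS.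
  rewrite -(take_takel t (leqnSn _)) -[(size acc).+1](size_rcons acc v) Et.
  by rewrite -cats1 take_size_cat.
case=> t [st Et pt ft].
have lt : size acc < size t by rewrite st -addSnnS leq_addr.
have Ev : take (size acc).+1 t = rcons acc (nth 0 t (size acc)).
  by rewrite (take_nth 0 lt) Et.
have vc : nth 0 t (size acc) \in cand by case: pt => _ sub _; apply/sub/mem_nth.
have pv : partial_copy (rcons acc (nth 0 t (size acc))).
  by rewrite -Ev; apply: partial_copy_take.
apply/hasP; exists (nth 0 t (size acc)) => //; apply/andP; split.
  by case/partial_copy_rcons: pv.
by apply/(IH _ pv); exists t; rewrite size_rcons Ev st addSnnS.
Qed.

Lemma search0P k : search k [::] <-> exists t, [/\ size t = k, partial_copy t & fin t].
Proof.
have p0 : partial_copy [::] by split=> // i j; rewrite ltn0 andbF.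
split=> [/(searchP _ p0)[t [st _ pt ft]]|[t [st pt ft]]]; first by exists t.
by apply/(searchP _ p0); exists t; rewrite take0.
Qed.

End Search.

Definition tab (M : seq (seq bool)) : rel nat := fun i j => nth false (nth [::] M i) j.

Definition matrix E s := [seq [seq eadj E i j | j <- s] | i <- s].

Lemma tabE E s i j : i < size s -> j < size s ->
  tab (matrix E s) i j = eadj E (nth 0 s i) (nth 0 s j).
Proof. by move=> is_ js; rewrite /tab (nth_map 0) // (nth_map 0). Qed.

Lemma tab_iota E n i j : i \in iota 0 n -> j \in iota 0 n ->
  tab (matrix E (iota 0 n)) i j = eadj E i j.
Proof. by rewrite !mem_iota /= add0n => im jm; rewrite tabE ?size_iota // !nth_iota. Qed.

(* Does the graph with edges E on s embed, as an induced subgraph whose vertex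
   list satisfies fin, into edge_graph n E'? *)
Definition embeds E s n E' (fin : pred (seq nat)) :=
  search (tab (matrix E s)) (tab (matrix E' (iota 0 n))) (iota 0 n) fin (size s) [::].

Section Models.
Variable R : sgraph.
Implicit Types (E : seq (nat * nat)) (s t : seq nat).

Definition model E s := uniq s /\ exists h : R -> nat,
  [/\ injective h, (forall x, h x \in s), (forall i, i \in s -> exists x, h x = i)
    & forall x y, adj x y = eadj E (h x) (h y)].

Lemma model_size E s : model E s -> #|R| = size s.
Proof.
case=> Us [h [hI hs sh _]].
have Um : uniq (map h (enum R)) by rewrite map_inj_uniq ?enum_uniq.
rewrite cardE -(size_map h); apply/perm_size/uniq_perm => // i; apply/idP/idP =>
  [/mapP[x _ ->]|/sh[x <-]]; first exact: hs.
by rewrite map_f ?mem_enum.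
Qed.

Lemma model_lift E s : model E s -> forall n E' s', model E' s' -> {subset s' <= iota 0 n} ->
  forall fin : pred (seq nat), (forall t, {subset t <= s'} -> fin t) ->
  embeds E s n E' fin.
Proof.
case=> Us [h [hI hs sh hadj]] n E' s' [Us' [h' [hI' hs' sh' hadj']]] sub fin finP.
have [xs Exs] : exists xs, map h xs = s.
  have : {subset s <= s} by []; elim: {-2}s => [|i r IH] rs; first by exists [::].
  have [xs Er] := IH (fun j jr => rs j (mem_behead (s := i :: r) jr)).
  by have [x Ex] := sh i (rs i (mem_head _ _)); exists (x :: xs); rewrite /= Ex Er.
have Uxs : uniq xs by rewrite -(map_inj_uniq hI) Exs.
apply/search0P; exists (map h' xs); split; first by rewrite -Exs !size_map.
  split; first by rewrite map_inj_uniq.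
    by move=> i /mapP[x _ ->]; apply: sub.
  move=> i j /andP[ij]; rewrite size_map => js; have is_ := ltn_trans ij js.
  case: xs Exs Uxs js is_ => // x0 xs Exs Uxs js is_.
  rewrite [RHS]tabE -?Exs ?size_map // !(nth_map x0) // tab_iota; try by apply: sub.
  by rewrite -hadj' hadj.
by apply: finP => i /mapP[x _ ->].
Qed.

Lemma embeds_iso E s E' m fin : model E s -> size s = m -> embeds E s m E' fin ->
  isomorphic R (edge_graph m E').
Proof.
move=> M sm /search0P[t [st [Ut sub adjt] _]]; rewrite sm in st.
have cR := model_size M; case: M => Us [h [hI hs sh hadj]].
have ih x : index (h x) s < m by rewrite -sm index_mem.
have tm x : nth 0 t (index (h x) s) < m.
  by have := sub (nth 0 t (index (h x) s)); rewrite mem_nth ?st // mem_iota => /(_ isT).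
exists (fun x => Ordinal (tm x) : edge_graph m E'); split.
  apply: inj_card_bij; last by rewrite card_ord cR sm.
  move=> x y /(congr1 val) /= /eqP; rewrite nth_uniq ?st // => /eqP/(congr1 (nth 0 s)).
  by rewrite !nth_index // => /hI.
have Hlt x y : index (h x) s < index (h y) s ->
    eadj E' (nth 0 t (index (h x) s)) (nth 0 t (index (h y) s)) = adj x y.
  move=> ixy; rewrite -(@tab_iota E' m); try by apply/sub/mem_nth; rewrite st.
  by rewrite adjt ?ixy ?st ?ih // tabE ?index_mem // !nth_index // -hadj.
move=> x y; rewrite -[LHS]/(eadj E' (nth 0 t (index (h x) s)) (nth 0 t (index (h y) s))).
have [ixy|iyx|E0] := ltngtP (index (h x) s) (index (h y) s); first exact: Hlt.
  by rewrite eadj_sym adj_sym Hlt.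
have -> : x = y by apply: hI; rewrite -(nth_index 0 (hs x)) E0 nth_index.
by rewrite adj_irr eadj_irr.
Qed.

Lemma model_of_iso m E : isomorphic R (edge_graph m E) -> model E (iota 0 m).
Proof.
case=> f [[g fK gK] fadj]; split; first exact: iota_uniq.
exists (fun x => val (f x)); split.
- by move=> x y /val_inj/(can_inj fK).
- by move=> x; rewrite mem_iota /= add0n.
- by move=> i; rewrite mem_iota add0n => im; exists (g (Ordinal im)); rewrite gK.
by move=> x y; rewrite -fadj.
Qed.

Fixpoint sublists (T : Type) (s : seq T) :=
  if s is x :: s' then let r := sublists s' in r ++ map (cons x) r else [:: [::]].

Lemma mem_sublists (T : eqType) (s t : seq T) : subseq t s -> t \in sublists s.
Proof.
elim: s t => [|x s IH] [|y t] //=.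
  by move=> _; rewrite mem_cat (IH [::]) ?sub0seq.
rewrite mem_cat; case: eqP => [->|_] tS; last by rewrite IH.
by apply/orP; right; rewrite map_f // IH.
Qed.

Definition edeg E n i := count (eadj E i) (iota 0 n).

Definition light_matrix E n :=
  let d := [seq edeg E n i | i <- iota 0 n] in
  [seq [seq [|| i == j, eadj E i j | nth 0 d i + nth 0 d j < n] | j <- iota 0 n]
  | i <- iota 0 n].

Definition all_pairs (M : seq (seq bool)) t := all (fun i => all (tab M i) t) t.

Definition light E n := all_pairs (light_matrix E n).

Lemma light_matrixE E n i j : i < n -> j < n ->
  tab (light_matrix E n) i j = [|| i == j, eadj E i j | edeg E n i + edeg E n j < n].
Proof.
by move=> lin ljn; rewrite /tab !(nth_map 0) ?size_iota // !nth_iota // !add0n.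
Qed.

Lemma deg_edge_graph n E (i : edge_graph n E) : deg i = edeg E n (val i).
Proof.
rewrite /deg /edeg -val_enum_ord count_map enumT cardsE cardE /enum_mem size_filter.
by apply: eq_count.
Qed.

Lemma model_of_induced n E (A : {set edge_graph n E}) :
  isomorphic (induced A) R -> ~ heavy_set A ->
  exists s, [/\ s \in sublists (iota 0 n), model E s & light E n s].
Proof.
case=> f [[g fK gK] fadj] Nh; exists (map val (enum A)); split.
- apply: mem_sublists; rewrite -val_enum_ord; apply: map_subseq.
  by rewrite enumT; apply: filter_subseq.
- split; first by rewrite map_inj_uniq ?enum_uniq //; apply: val_inj.
  exists (fun x => val (val (g x))); split.
  + by move=> x y /val_inj/val_inj/(can_inj gK).
  + by move=> x; rewrite map_f // mem_enum (valP (g x)).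
  + move=> i /mapP[v]; rewrite mem_enum => vA ->.
    by exists (f (exist _ v vA)); rewrite fK.
  by move=> x y; rewrite -[RHS]/(adj (g x) (g y)) -fadj !gK.
apply/allP => i /mapP[u]; rewrite mem_enum => uA ->.
apply/allP => j /mapP[v]; rewrite mem_enum => vA ->.
rewrite light_matrixE ?ltn_ord // ltnNge -!deg_edge_graph; apply/negPn/negP;
  rewrite !negb_or negbK => /and3P[uv Nuv huv].
by apply: Nh; exists u, v; split=> //; rewrite card_ord.
Qed.

End Models.

Definition spread (e : rel nat) (s S : seq nat) :=
  [seq j <- s | if j \in S then true else has (fun i => e i j) S].

Definition reach (e : rel nat) s := iter (size s) (spread e s) [:: head 0 s].

Definition looks_connected (e : rel nat) s :=
  let S := reach e s in
  all (mem S) s || has (fun i => has (fun j => (j \notin S) && e i j) s) S.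

Section Checks.
Variables (n : nat) (E : seq (nat * nat)).

Definition neighbors := [seq [seq j <- iota 0 n | eadj E i j] | i <- iota 0 n].

Fixpoint spanning_walk (nb : seq (seq nat)) k visited i :=
  if k is k'.+1 then has (fun j => if j \notin visited
    then spanning_walk nb k' (j :: visited) j else false) (nth [::] nb i)
  else 0 \in nth [::] nb i.

Lemma mem_neighbors (i j : edge_graph n E) :
  (val j \in nth [::] neighbors (val i)) = adj i j.
Proof.
rewrite /neighbors (nth_map 0) ?size_iota ?ltn_ord // nth_iota ?ltn_ord //.
by rewrite add0n mem_filter mem_iota /= ltn_ord andbT.
Qed.

Lemma spanning_walk_complete (z x : edge_graph n E) (s : seq (edge_graph n E)) visited :
  val z = 0 -> path (@adj _) x s -> uniq s -> ~~ has (mem visited) (map val s) ->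
  adj (last x s) z -> spanning_walk neighbors (size s) visited (val x).
Proof.
move=> z0; elim: s x visited => [|y s IH] x visited /=.
  by move=> _ _ _; rewrite -z0 mem_neighbors.
case/andP=> xy Ps /andP[ys Us]; rewrite negb_or => /andP[yv sv] Lz.
apply/hasP; exists (val y); first by rewrite mem_neighbors.
rewrite -[_ \notin _]/(~~ _) yv; apply: IH => //.
apply/hasPn => i /mapP[w ws ->]; rewrite /= inE negb_or.
rewrite (contra _ ys) => [|/eqP/val_inj <- //].
by move/hasPn: sv => /(_ _ (map_f val ws)).
Qed.

Lemma not_hamiltonian : 0 < n ->
  spanning_walk neighbors n.-1 [:: 0] 0 = false -> ~ hamiltonian (edge_graph n E).
Proof.
move=> n0 W [c [_ Uc Cc cover]].
pose z : edge_graph n E := Ordinal n0.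
have [i c' Ec] := rot_to (cover z).
have Uc' : uniq (z :: c') by rewrite -Ec rot_uniq.
have sc : size (z :: c') = n.
  rewrite -Ec size_rot -(card_uniqP Uc) -[RHS]card_ord; apply: eq_card => x.
  by rewrite cover.
have : cycle (@adj _) (z :: c') by rewrite -Ec rot_cycle.
rewrite /= rcons_path => /andP[Pc Lc]; case/andP: Uc' => zc' Uc'.
have := @spanning_walk_complete z z c' [:: 0] erefl Pc Uc' _ Lc.
have sc' : size c' = n.-1 by have := congr1 predn sc.
rewrite sc' W => H; suff : false by []; apply: H.
apply/hasPn => j /mapP[w wc ->]; apply: contra zc'; rewrite /= inE => /eqP w0.
by have -> : z = w by apply: val_inj; apply: esym w0.
Qed.

Definition connected_without (e : rel nat) k :=
  let s := [seq i <- iota 0 n | i != k] in (0 < size s) && all (mem (reach e s)) s.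

Lemma connected_withoutP k (A : {set edge_graph n E}) :
  (forall v : edge_graph n E, (v \in A) = (val v != k)) ->
  connected_without (tab (matrix E (iota 0 n))) k -> connected (induced A).
Proof.
move=> AE; rewrite /connected_without; set s := filter _ _; set e := tab _.
case/andP=> s0 /allP rs.
have sP i : i \in s -> exists x : induced A, val (val x) = i.
  rewrite mem_filter mem_iota /= add0n => /andP[ik lin].
  have xA : (Ordinal lin : edge_graph n E) \in A by rewrite AE.
  by exists (exist (fun v => v \in A) (Ordinal lin : edge_graph n E) xA).
have hs : head 0 s \in s by case: (s) s0 => // i r _; apply: mem_head.
have [r0 Er0] := sP _ hs.
have iterP k' i : i \in iter k' (spread e s) [:: head 0 s] ->
    exists x : induced A, val (val x) = i /\ connect (@adj _) r0 x.
  elim: k' i => [|k' IH] i /=.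
    by rewrite inE => /eqP->; exists r0; split=> //; apply: connect0.
  rewrite mem_filter => /andP[/orP[/IH//|/hasP[j /IH[y [Ey cy]] ji]] /sP[x Ex]].
  exists x; split=> //; apply: connect_trans cy (connect1 _).
  rewrite -[adj _ _]/(eadj E (val (val y)) (val (val x))) -(@tab_iota E n) ?mem_iota ?ltn_ord //.
  by rewrite Ey Ex.
have all_r x : connect (@adj _) r0 x.
  have : val (val x) \in s.
    by rewrite mem_filter mem_iota /= -AE (valP x) ltn_ord.
  move=> /rs/iterP[y [Ey cy]]; suff <- : y = x by [].
  by apply/val_inj/val_inj.
split; first by apply/card_gt0P; exists r0.
move=> x y; apply: connect_trans (all_r y).
by rewrite sym_connect_sym //; apply: adj_sym.
Qed.

Lemma two_connected : 2 < n ->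
  all (connected_without (tab (matrix E (iota 0 n)))) (iota 0 n.+1) ->
  k_connected 2 (edge_graph n E).
Proof.
move=> n2 /allP cw; split=> [|A]; first by rewrite card_ord.
rewrite ltnS leq_eqVlt ltnS leqn0 => /orP[/cards1P[v ->]|/eqP/cards0_eq->].
  apply: (connected_withoutP (k := val v)) => [w|].
    by rewrite !inE -(inj_eq val_inj).
  by apply: cw; rewrite mem_iota /= add0n ltnS ltnW // ltn_ord.
apply: (connected_withoutP (k := n)) => [w|]; last by apply: cw; rewrite mem_iota /= add0n.
by rewrite !inE neq_ltn ltn_ord.
Qed.

Lemma looks_connectedP (R : sgraph) s : connected R -> model R E s ->
  {subset s <= iota 0 n} -> looks_connected (tab (matrix E (iota 0 n))) s.
Proof.
move=> [R0 Rc] [Us [h [hI hs sh hadj]]] sub; rewrite /looks_connected.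
set e := tab _; set S := reach e s.
apply/orP; have [|NS] := boolP (all (mem S) s); [by left | right].
have /allPn[i is_ iS] := NS; rewrite /= in iS.
have s0 : head 0 s \in s by case: (s) is_ => // j r _; apply: mem_head.
have hS : head 0 s \in S.
  rewrite /S /reach; elim: (size s) => [|k IH]; first by rewrite /= mem_head.
  by rewrite iterS mem_filter IH s0.
have [x Ex] := sh _ s0; have [y Ey] := sh _ is_.
apply: contraT => /hasPn cl.
have clo : closed (@adj R) [pred z | h z \in S].
  apply: intro_closed; first by apply: sym_connect_sym; apply: adj_sym.
  move=> u v uv; rewrite !inE => uS; apply: contraT => vS.
  move/hasPn: (cl _ uS) => /(_ _ (hs v)); rewrite vS /= /e tab_iota; try exact/sub/hs.
  by rewrite -hadj uv.
by have := closed_connect clo (Rc x y); rewrite !inE Ex Ey hS (negbTE iS).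
Qed.

End Checks.

Lemma copies_in_wounded (G : sgraph) (s : seq G) :
  size s = 6 -> light_copy wounded_edges 0 s ->
  [/\ exists2 t : seq G, size t = 4 & light_copy (path_edges 4) 0 t,
      exists2 t : seq G, size t = 5 & light_copy (path_edges 5) 0 t,
      exists2 t : seq G, size t = 3 & light_copy triangle_edges 0 t
    & [/\ exists2 t : seq G, size t = 4 & light_copy ((0, 2) :: path_edges 4) 0 t,
          exists2 t : seq G, size t = 5 & light_copy ((0, 2) :: path_edges 5) 0 t
        & exists2 t : seq G, size t = 5 &
            light_copy (triangle_edges ++ [:: (0, 3); (1, 4)]) 0 t]].
Proof.
case: s => [|t0 [|t1 [|t2 [|t3 [|t4 [|t5 [|]]]]]]] // _.
rewrite /light_copy /fits_row /fits /= !andbT.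
case/and5P=> /and5P[a01 a02 a03 n04 n05] /and4P[a12 n13 a14 n15] /and3P[n23 n24 n25].
case/andP=> n34 n35 a45.
have [a30 a21 a41] :=
  And3 (etrans (adj_sym _ _) a03) (etrans (adj_sym _ _) a12) (etrans (adj_sym _ _) a14).
have n31 := etrans (apart_sym _ _) n13.
split; last split.
- by exists [:: t3; t0; t1; t4]; rewrite // /light_copy /fits_row /fits /= a30 n31 n34 a01 n04 a14.
- exists [:: t3; t0; t1; t4; t5]; rewrite // /light_copy /fits_row /fits /=.
  by rewrite a30 n31 n34 n35 a01 n04 n05 a14 n15 a45.
- by exists [:: t0; t1; t2]; rewrite // /light_copy /fits_row /fits /= a01 a02 a12.
- exists [:: t0; t2; t1; t4]; rewrite // /light_copy /fits_row /fits /=.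
  by rewrite a02 a01 n04 a21 n24 a14.
- exists [:: t0; t2; t1; t4; t5]; rewrite // /light_copy /fits_row /fits /=.
  by rewrite a02 a01 n04 n05 a21 n24 n25 a14 n15 a45.
exists [:: t0; t1; t2; t3; t4]; rewrite // /light_copy /fits_row /fits /=.
by rewrite a01 a02 a03 n04 a12 n13 a14 n23 n24 n34.
Qed.

(** * The exceptional graphs *)

Definition claw_edges := [:: (0, 1); (0, 2); (0, 3)].
Definition c4_edges := [:: (0, 1); (1, 2); (2, 3); (0, 3)].
Definition k23_edges := [:: (0, 2); (0, 3); (0, 4); (1, 2); (1, 3); (1, 4)].
Definition k113_edges := (0, 1) :: k23_edges.

(* Three paths with two inner vertices each between 0 and 1. *)
Definition theta_edges :=
  [:: (0, 2); (2, 3); (3, 1); (0, 4); (4, 5); (5, 1); (0, 6); (6, 7); (7, 1)].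

(* The paths i, i + 6, i + 3 for i = 0, 1, 2, and the chords closing them. *)
Definition three_paths := [:: (0, 6); (1, 7); (2, 8); (3, 6); (4, 7); (5, 8)].
Definition three_chords := [:: (0, 3); (1, 4); (2, 5)].

Definition p333_edges := triangle_edges ++ [:: (3, 4); (4, 5); (3, 5)] ++ three_paths.
Definition pttt_edges := p333_edges ++ three_chords.

(* The second triangle of the previous graph is replaced by three independent
   vertices 3, 4, 5 complete to a 5-clique; these have degree 7, half of the
   order, so that every induced claw or P6 through two of them is heavy. *)
Definition p6_heavy_edges := triangle_edges ++ three_paths ++ three_chords
  ++ [seq (i, j) | i <- iota 3 3, j <- iota 9 5]
  ++ [seq e <- [seq (i, j) | i <- iota 9 5, j <- iota 9 5] | e.1 < e.2].

Definition is_shape E s m E' :=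
  if size s == m then embeds E s m E' xpredT else false.

Definition proper e E s :=
  if 2 < size s then if looks_connected e s then ~~ is_shape E s 3 (path_edges 3)
  else false else false.

Definition is_partner E s :=
  [|| is_shape E s 4 (path_edges 4), is_shape E s 5 (path_edges 5),
      is_shape E s 3 triangle_edges, is_shape E s 4 ((0, 2) :: path_edges 4),
      is_shape E s 5 ((0, 2) :: path_edges 5),
      is_shape E s 5 (triangle_edges ++ [:: (0, 3); (1, 4)]),
      is_shape E s 6 net_edges | is_shape E s 6 wounded_edges].

Definition edge_tab n E := tab (matrix E (iota 0 n)).

Lemma k23_edges_connected :
  all (connected_without 5 (edge_tab 5 k23_edges)) (iota 0 6) = true.
Proof. by vm_compute. Qed.

Lemma k23_edges_walk : spanning_walk (neighbors 5 k23_edges) 4 [:: 0] 0 = false.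
Proof. by vm_compute. Qed.

Lemma k113_edges_connected :
  all (connected_without 5 (edge_tab 5 k113_edges)) (iota 0 6) = true.
Proof. by vm_compute. Qed.

Lemma k113_edges_walk : spanning_walk (neighbors 5 k113_edges) 4 [:: 0] 0 = false.
Proof. by vm_compute. Qed.

Lemma theta_edges_connected :
  all (connected_without 8 (edge_tab 8 theta_edges)) (iota 0 9) = true.
Proof. by vm_compute. Qed.

Lemma theta_edges_walk : spanning_walk (neighbors 8 theta_edges) 7 [:: 0] 0 = false.
Proof. by vm_compute. Qed.

Lemma p333_edges_connected :
  all (connected_without 9 (edge_tab 9 p333_edges)) (iota 0 10) = true.
Proof. by vm_compute. Qed.

Lemma p333_edges_walk : spanning_walk (neighbors 9 p333_edges) 8 [:: 0] 0 = false.
Proof. by vm_compute. Qed.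

Lemma pttt_edges_connected :
  all (connected_without 9 (edge_tab 9 pttt_edges)) (iota 0 10) = true.
Proof. by vm_compute. Qed.

Lemma pttt_edges_walk : spanning_walk (neighbors 9 pttt_edges) 8 [:: 0] 0 = false.
Proof. by vm_compute. Qed.

Lemma p6_heavy_edges_connected :
  all (connected_without 14 (edge_tab 14 p6_heavy_edges)) (iota 0 15) = true.
Proof. by vm_compute. Qed.

Lemma p6_heavy_edges_walk : spanning_walk (neighbors 14 p6_heavy_edges) 13 [:: 0] 0 = false.
Proof. by vm_compute. Qed.

Lemma k23_check :
  (let e := edge_tab 5 k23_edges in all (fun s => if proper e k23_edges s
    then [|| is_shape k23_edges s 4 claw_edges, is_shape k23_edges s 4 c4_edges
           | is_shape k23_edges s 5 k23_edges] else true) (sublists (iota 0 5))) = true.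
Proof. by vm_compute. Qed.

Lemma k113_check :
  (let e := edge_tab 5 k113_edges in all (fun s => if proper e k113_edges s
    then if embeds k113_edges s 8 theta_edges xpredT
         then ~~ embeds k113_edges s 9 p333_edges xpredT else true
    else true) (sublists (iota 0 5))) = true.
Proof. by vm_compute. Qed.

Lemma pttt_check :
  (let e := edge_tab 9 pttt_edges in all (fun s => if proper e pttt_edges s
    then if is_partner pttt_edges s then true
         else if embeds pttt_edges s 9 p333_edges xpredT
         then ~~ embeds pttt_edges s 14 p6_heavy_edges (light p6_heavy_edges 14) else true
    else true) (sublists (iota 0 9))) = true.
Proof. by vm_compute. Qed.

Definition absent m E n E' := embeds E (iota 0 m) n E' xpredT = false.

Lemma c4_absent : [/\ absent 4 c4_edges 5 k113_edges, absent 4 c4_edges 8 theta_edges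
  & absent 4 c4_edges 9 p333_edges].
Proof. by vm_compute. Qed.

Lemma k23_absent : [/\ absent 5 k23_edges 5 k113_edges, absent 5 k23_edges 8 theta_edges
  & absent 5 k23_edges 9 p333_edges].
Proof. by vm_compute. Qed.

Lemma claw_absent : [/\ absent 4 claw_edges 9 pttt_edges, absent 4 claw_edges 9 p333_edges
  & embeds claw_edges (iota 0 4) 14 p6_heavy_edges (light p6_heavy_edges 14) = false].
Proof. by vm_compute. Qed.

Definition light_model (X : sgraph) n E :=
  exists s, [/\ s \in sublists (iota 0 n), model X E s & light E n s].

Lemma sublists_sub (T : eqType) (s t : seq T) : t \in sublists s -> {subset t <= s}.
Proof.
elim: s t => [|x s IH] t /=; first by rewrite inE => /eqP->.
rewrite mem_cat => /orP[/IH ts y /ts|/mapP[u /IH us -> y]]; first by rewrite inE orbC => ->.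
by rewrite !inE => /orP[->//|/us->]; rewrite orbT.
Qed.

Lemma not_heavy_model X n E : ~ heavy X (edge_graph n E) -> light_model X n E.
Proof.
move=> Nh; apply: NNPP => Nm; apply: Nh => A AX; apply: NNPP => Nh.
by have [s sP] := model_of_induced AX Nh; apply: Nm; exists s.
Qed.

Lemma light_model_proper (X : sgraph) n E : connected X -> 2 < #|X| ->
  ~ isomorphic X (P 3) -> light_model X n E ->
  exists s, [/\ s \in sublists (iota 0 n), model X E s & proper (edge_tab n E) E s].
Proof.
move=> Xc X2 X3 [s [sn sm _]]; exists s; split=> //.
rewrite /proper -(model_size sm) X2 (looks_connectedP Xc sm (sublists_sub sn)).
rewrite /is_shape; case: eqP => // s3; apply/negP => /(embeds_iso sm s3); exact: X3.
Qed.

Lemma light_model_embeds (X : sgraph) n E E' s : model X E' s -> light_model X n E ->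
  embeds E' s n E xpredT /\ embeds E' s n E (light E n).
Proof.
move=> sm [t [tn tm tl]]; have sub := sublists_sub tn; split;
  first exact: model_lift sm _ _ _ tm sub _ _.
apply: (model_lift sm tm sub) => r rt; apply/allP => i /rt it; apply/allP => j /rt jt.
by move/allP: tl => /(_ i it)/allP/(_ j jt).
Qed.

Lemma is_shape_iso (X : sgraph) E s m E' : model X E s -> is_shape E s m E' ->
  isomorphic X (edge_graph m E').
Proof. by move=> sm; rewrite /is_shape; case: eqP => // sz; apply: embeds_iso sm sz. Qed.

Lemma is_partner_iso (X : sgraph) E s : model X E s -> is_partner E s ->
  isomorphic X (P 4) \/ isomorphic X (P 5) \/ isomorphic X C3 \/
  isomorphic X (Z 1) \/ isomorphic X (Z 2) \/ isomorphic X bull \/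
  isomorphic X net \/ isomorphic X wounded.
Proof.
move=> sm; case/or4P=> [/(is_shape_iso sm)|/(is_shape_iso sm)|/(is_shape_iso sm)|].
- by left.
- by right; left.
- by do 2 right; left.
case/or4P=> [/(is_shape_iso sm)|/(is_shape_iso sm)|/(is_shape_iso sm)|].
- by do 3 right; left.
- by do 4 right; left.
- by do 5 right; left.
by case/orP=> /(is_shape_iso sm); [do 6 right; left | do 7 right].
Qed.

Section Necessity.
Variables R S : sgraph.
Hypotheses (R_conn : connected R) (S_conn : connected S).
Hypotheses (R_card : 2 < #|R|) (S_card : 2 < #|S|).
Hypotheses (R_neq_P3 : ~ isomorphic R (P 3)) (S_neq_P3 : ~ isomorphic S (P 3)).
Hypothesis either : forall n E, 2 < n ->
  all (connected_without n (edge_tab n E)) (iota 0 n.+1) = true ->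
  spanning_walk (neighbors n E) n.-1 [:: 0] 0 = false ->
  light_model R n E \/ light_model S n E.

Lemma forced n E m E' fin : all (connected_without n (edge_tab n E)) (iota 0 n.+1) = true ->
  spanning_walk (neighbors n E) n.-1 [:: 0] 0 = false -> 2 < n ->
  model R E' (iota 0 m) -> embeds E' (iota 0 m) n E fin = false ->
  fin = xpredT \/ fin = light E n -> light_model S n E.
Proof.
move=> cE wE n2 Rm ab fP; case: (either n2 cE wE) => // Rn.
by have [e1 e2] := light_model_embeds Rm Rn; case: fP ab => ->; rewrite ?e1 ?e2.
Qed.

Lemma partner_of_claw : isomorphic R (edge_graph 4 claw_edges) -> claw_and_partner R S.
Proof.
move=> Rclaw; split; first exact: Rclaw.
have Rm := model_of_iso Rclaw; have [c1 c2 c3] := claw_absent.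
have S1 : light_model S 9 pttt_edges.
  by apply: (forced pttt_edges_connected pttt_edges_walk isT Rm c1); left.
have S2 : light_model S 9 p333_edges.
  by apply: (forced p333_edges_connected p333_edges_walk isT Rm c2); left.
have S3 : light_model S 14 p6_heavy_edges.
  by apply: (forced p6_heavy_edges_connected p6_heavy_edges_walk isT Rm c3); right.
have [s [sn sm sp]] := light_model_proper S_conn S_card S_neq_P3 S1.
have [e2 _] := light_model_embeds sm S2; have [_ e3] := light_model_embeds sm S3.
have := allP pttt_check s sn; rewrite sp e2 e3.
case Ep: (is_partner _ s) => H; last discriminate H.
exact: is_partner_iso sm Ep.
Qed.

Lemma no_partner m E : isomorphic R (edge_graph m E) ->
  [/\ absent m E 5 k113_edges, absent m E 8 theta_edges & absent m E 9 p333_edges] -> False.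
Proof.
move=> /model_of_iso Rm [c1 c2 c3].
have S1 : light_model S 5 k113_edges.
  by apply: (forced k113_edges_connected k113_edges_walk isT Rm c1); left.
have S2 : light_model S 8 theta_edges.
  by apply: (forced theta_edges_connected theta_edges_walk isT Rm c2); left.
have S3 : light_model S 9 p333_edges.
  by apply: (forced p333_edges_connected p333_edges_walk isT Rm c3); left.
have [s [sn sm sp]] := light_model_proper S_conn S_card S_neq_P3 S1.
have [e2 _] := light_model_embeds sm S2; have [e3 _] := light_model_embeds sm S3.
by have := allP k113_check s sn; rewrite sp e2 e3 => H; discriminate H.
Qed.

Lemma necessity_half : light_model R 5 k23_edges -> claw_and_partner R S.
Proof.
move=> /(light_model_proper R_conn R_card R_neq_P3)[s [sn sm sp]].
have := allP k23_check s sn; rewrite sp => /or3P[] /(is_shape_iso sm).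
- exact: partner_of_claw.
- by move/no_partner/(_ c4_absent).
- by move/no_partner/(_ k23_absent).
Qed.

End Necessity.

Lemma hamiltonian_of_partner (R S G : sgraph) : claw_and_partner R S ->
  k_connected 2 G -> heavy R G -> heavy S G -> hamiltonian G.
Proof.
move=> [RK SP] G2 /(heavy_iso RK) hK hS.
have [//|[[s s6 ls] [t t6 lt]]] := light_copies_of_nonhamiltonian G2 hK.
have [[u4 s4 l4] [u5 s5 l5] [u3 s3 l3] [[z1 sz1 lz1] [z2 sz2 lz2] [bu sb lb]]] :=
  copies_in_wounded t6 lt.
exfalso; move: SP; case=> [|[|[|[|[|[|[|]]]]]]] /heavy_iso/(_ hS) hP.
- exact: (no_light_copy hP isT s4 l4).
- exact: (no_light_copy hP isT s5 l5).
- exact: (no_light_copy hP isT s3 l3).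
- exact: (no_light_copy hP isT sz1 lz1).
- exact: (no_light_copy hP isT sz2 lz2).
- exact: (no_light_copy hP isT sb lb).
- exact: (no_light_copy hP isT s6 ls).
exact: (no_light_copy hP isT t6 lt).
Qed.

Theorem theorem5 (R S : sgraph)
  (R_conn : connected R) (S_conn : connected S)
  (R_card : 2 < #|R|) (S_card : 2 < #|S|)
  (R_neq_P3 : ~ isomorphic R (P 3)) (S_neq_P3 : ~ isomorphic S (P 3)) :
  (forall G : sgraph,
     k_connected 2 G -> family_heavy (pair_family R S) G -> hamiltonian G)
  <-> (claw_and_partner R S \/ claw_and_partner S R).
Proof.
split=> [all_ham|[C|C] G G2 hG]; last first.
- by apply: (hamiltonian_of_partner C G2); apply: hG; [right | left].
- by apply: (hamiltonian_of_partner C G2); apply: hG; [left | right].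
have either n E : 2 < n -> all (connected_without n (edge_tab n E)) (iota 0 n.+1) = true ->
    spanning_walk (neighbors n E) n.-1 [:: 0] 0 = false ->
    light_model R n E \/ light_model S n E.
  move=> n2 cE wE; have G2 := two_connected n2 cE.
  have Nham := not_hamiltonian (ltnW (ltnW n2)) wE.
  have [hR|/not_heavy_model] := classic (heavy R (edge_graph n E)); last by left.
  have [hS|/not_heavy_model] := classic (heavy S (edge_graph n E)); last by right.
  by case: Nham; apply: all_ham G2 _ => H [] ->.
case: (either 5 k23_edges isT k23_edges_connected k23_edges_walk).
  by left; apply: necessity_half either _.
right; apply: necessity_half => // n E n2 cE wE.
by case: (either n E n2 cE wE); [right | left].
Qed.
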